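(* Let $d>0$ be an integer and let $\{1,\ldots,d\}=\coprod_{i=1}^N T_i$ be a partition, with $d_i=|T_i|$. Let $G$ be a directed graph on $d$ vertices $v_1,\ldots,v_d$, without self-loops, with the property that for any $v_j$ and $T_i$, if there is some $k\in T_i$ such that there is an edge from $v_j$ to $v_k$ in $G$, then for every $k\in T_i$ there is an edge from $v_j$ to $v_k$ in $G$. Let $$f_1(\sigma_1,\ldots,\sigma_d)=0,\quad f_2(\sigma_1,\ldots,\sigma_d)=0,\quad\ldots,\quad f_d(\sigma_1,\ldots,\sigma_d)=0$$ be a system of $d$ polynomial equations in $d$ variables $\sigma_1,\ldots,\sigma_d$ with the following properties: (1) all monomials occurring in the $f_j$'s are squarefree; (2) if $j,k\in T_i$ with $j\neq k$, then $\sigma_j$ and $\sigma_k$ do not both occur in any monomial of any of the $f$'s; (3) if there is no edge from $v_j$ to $v_k$ in $G$, then the variable $\sigma_k$ does not occur in $f_j$. (Thus the equations are multilinear, and they are linear over the variables from each $T_i$.) Construct a $d\times d$ matrix $M$ as follows: if the variable $\sigma_k$ occurs in the polynomial $f_j$, with $T_i$ the part containing $k$, then $$M_{jk}=\frac{1}{(d_i!)^{1/d_i}},$$ and otherwise $M_{jk}=0$. If the system is $0$-dimensional, then the number of its solutions in $(\mathbb{C}^* )^d$ (i.e. such that $\sigma_k\neq 0$ for all $k$) is bounded above by the permanent of $M$, and is equal to the permanent of $M$ for generic coefficients.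
   Context: The polynomials have complex coefficients and solutions are complex. ''$0$-dimensional'' means that the solution set does not have positive dimension, i.e. there are only finitely many (possibly no) solutions. ''Generic coefficients'' means that the coefficients are generic subject to the sparsity conditions (1)-(3) imposed by the given partition and graph $G$.
   Formalization: M_{jk} is taken nonzero when G has an edge from v_j to v_k, rather than when σ_k occurs in f_j; with literal occurrence the bound fails, e.g. parts {1,2},{3,4} and f=(σ3−1,σ4−1,σ1−1,σ2−1) has 1 solution but permanent 1/4. *)

(* Defs.v *)
(* MathComp, with the classical sets and the real numbers of
   MathComp-Analysis: the field of complex numbers is R[i] for R : realType. *)
From mathcomp Require Import all_boot all_order all_algebra all_fingroup.
From mathcomp Require Import complex.
From mathcomp Require Import boolp classical_sets functions cardinality reals.
From mathcomp Require Import mpoly.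

Set Implicit Arguments.
Unset Strict Implicit.
Unset Printing Implicit Defensive.

Import Order.TTheory GRing.Theory Num.Theory.
Local Open Scope ring_scope.

Definition permanent (K : pzRingType) (n : nat) (A : 'M[K]_n) : K :=
  \sum_(s : 'S_n) \prod_(i < n) A i (s i).

(* [occurs k p]: the variable 'X_k occurs in the polynomial p, that is, in one
   of the monomials having a nonzero coefficient in p. *)
Definition occurs (K : nzRingType) (d : nat) (k : 'I_d) (p : {mpoly K[d]}) :
    bool :=
  has (fun m : 'X_{1.. d} => m k != 0%N) (msupp p).

(* P is the set of the parts T_i, and [G j k] means that there is an edge
   from v_j to v_k. *)
Definition sparsity_graph (d : nat) (P : {set {set 'I_d}}) (G : rel 'I_d) :
    Prop :=
  (forall j : 'I_d, ~~ G j j) /\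
  (forall (j : 'I_d) (T : {set 'I_d}), T \in P ->
     (exists2 k, k \in T & G j k) -> forall k, k \in T -> G j k).

Definition sparse_system (K : nzRingType) (d : nat) (P : {set {set 'I_d}})
    (G : rel 'I_d) (f : 'I_d -> {mpoly K[d]}) : Prop :=
  [/\ forall (j : 'I_d) (m : 'X_{1.. d}), m \in msupp (f j) ->
        forall k, (m k <= 1)%N,
      forall (T : {set 'I_d}) (j k : 'I_d), T \in P -> j \in T -> k \in T ->
        j != k ->
        forall (l : 'I_d) (m : 'X_{1.. d}), m \in msupp (f l) ->
          ~ (m j != 0%N /\ m k != 0%N)
    & forall j k : 'I_d, ~~ G j k -> ~~ occurs k (f j)].

Definition solutions (K : comNzRingType) (d : nat) (f : 'I_d -> {mpoly K[d]}) :
    set ('I_d -> K) :=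
  [set x | forall j, (f j).@[x] = 0].

Definition torus_solutions (K : comNzRingType) (d : nat)
    (f : 'I_d -> {mpoly K[d]}) : set ('I_d -> K) :=
  [set x | solutions f x /\ forall k, x k != 0].

Definition zero_dimensional (K : comNzRingType) (d : nat)
    (f : 'I_d -> {mpoly K[d]}) : Prop :=
  finite_set (solutions f).

(* Here n.-root is the nonnegative real root, its argument being a positive
   real number.  The pattern of nonzero entries is that of the variables
   occurring in the general system with the sparsity prescribed by P and G:
   there 'X_k occurs in f_j if and only if G has an edge from v_j to v_k.  The
   pattern of an individual system would not do, since particular coefficients
   may vanish: for the parts {0, 1} and {2, 3}, the system
     'X_2 - 1 = 'X_3 - 1 = 'X_0 - 1 = 'X_1 - 1 = 0
   has one solution, but the matrix built from the variables occurring in these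
   four polynomials has permanent 1/4. *)
Definition sparsity_mx (C : numClosedFieldType) (d : nat)
    (P : {set {set 'I_d}}) (G : rel 'I_d) : 'M[C]_d :=
  \matrix_(j < d, k < d)
    (let dk := #|finset.pblock P k| in
     if G j k then 1 / dk.-root (dk`!%:R) else 0).

Definition squarefree_mnm (d : nat) (S : {set 'I_d}) : 'X_{1.. d} :=
  [multinom (i \in S : nat) | i < d].

(* The coefficients of all squarefree monomials in f_0, ..., f_(d-1), listed as
   one finite family; a system subject to the sparsity conditions is determined
   by them. *)
Definition coefficients (K : nzRingType) (d : nat) (f : 'I_d -> {mpoly K[d]}) :
    'I_#|{: 'I_d * {set 'I_d}}| -> K :=
  fun a => (f (enum_val a).1)@_(squarefree_mnm (enum_val a).2).

(* Q holds for generic coefficients subject to the sparsity conditions: it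
   holds off the zero locus of some polynomial H in the coefficients, where H
   does not vanish identically on the linear space of all sparse systems. *)
Definition for_generic_coefficients (K : comNzRingType) (d : nat)
    (P : {set {set 'I_d}}) (G : rel 'I_d)
    (Q : ('I_d -> {mpoly K[d]}) -> Prop) : Prop :=
  exists H : {mpoly K[#|{: 'I_d * {set 'I_d}}|]},
    (exists2 f, sparse_system P G f & H.@[coefficients f] != 0) /\
    (forall f, sparse_system P G f -> H.@[coefficients f] != 0 -> Q f).

(* Main.v *)
(* Let N be the number of ways to choose, for each equation j, a block psi(j)
   occurring in it, so that each block T is chosen exactly |T| times; counting
   the permutations that respect a given choice shows that the permanent is N.

   A special sparse system p, each equation of which is a product of affine
   forms, one for each of its blocks, with coefficients on a moment curve, has
   exactly N zeros, all simple and in the torus.  Peeling off the factors one by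
   one, the polynomials of block degree at most k, for k large, are spanned
   modulo the ideal of p, in bounded degree, by N of them, which can be taken to
   be the powers of an affine form u separating the zeros.  Such a spanning
   property persists for generic systems.

   Upper bound: let f have finitely many zeros, n say.  As C is uncountable,
   the quotient by the ideal of f is spanned by finitely many e_a.  Hence the
   products f^alpha e_a with |alpha| < s surject onto the s-jets at the n zeros,
   a space of dimension n c(s), where c(s) is the number of the exponents alpha.
   The same holds for a generic g instead of f; but there Cramer's rule, for the
   systems g - y with y indeterminate, makes each e_a depend on N polynomials
   over C[g], so that these products span a space of dimension N c(s) + o(c(s)).
   Thus n <= N.

   Generic systems f: the upper bound, applied to the zeros of p with f as the
   generic system, shows that 1, u, ..., u^(N-1) are independent modulo f.  So
   the quotient is C[u]/(chi) with chi of degree N.  The Jacobian of f, being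
   invertible modulo f because this holds for p, forces chi to have simple
   roots, and these correspond to the zeros of f. *)
Require Import Defs.
From HB Require Import structures.
From mathcomp Require Import all_boot all_order all_algebra all_fingroup.
From mathcomp Require Import complex.
From mathcomp Require Import boolp classical_sets functions cardinality reals.
From mathcomp Require Import mpoly.
From mathcomp Require Import separable.
From mathcomp Require Import zify ring lra.
Import Order.TTheory GRing.Theory Num.Theory.
Local Open Scope ring_scope.

Set Implicit Arguments.
Unset Strict Implicit.
Unset Printing Implicit Defensive.

(** * Linear spans and ranks *)

Section LinearSpan.
Variables (K : nzRingType) (V : lmodType K).
Implicit Types (X Y : V -> Prop) (v w : V).

(** Spans of arbitrary predicates, since the generating sets used below, such as the multiples of
    the equations, are infinite. *)
Inductive lspan X : V -> Prop :=
| lspan0 : lspan X 0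
| lspan_cons (a : K) (x y : V) : X x -> lspan X y -> lspan X (a *: x + y).

Lemma lspan_mem X v : X v -> lspan X v.
Proof.
by move=> Xv; rewrite -[v]addr0 -[v]scale1r; apply: lspan_cons => //; exact: lspan0.
Qed.

Lemma lspanD X v w : lspan X v -> lspan X w -> lspan X (v + w).
Proof.
move=> Xv Xw; elim: Xv => [|a x y Xx _ IH]; first by rewrite add0r.
by rewrite -addrA; apply: lspan_cons.
Qed.

Lemma lspanZ X a v : lspan X v -> lspan X (a *: v).
Proof.
elim=> [|b x y Xx _ IH]; first by rewrite scaler0; exact: lspan0.
by rewrite scalerDr scalerA; apply: lspan_cons.
Qed.

Lemma lspanB X v w : lspan X v -> lspan X w -> lspan X (v - w).
Proof. by move=> Xv Xw; rewrite -scaleN1r; apply/lspanD/lspanZ. Qed.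

Lemma lspan_sum X (I : Type) (r : seq I) (P : pred I) (F : I -> V) :
  (forall i, P i -> lspan X (F i)) -> lspan X (\sum_(i <- r | P i) F i).
Proof.
by move=> XF; elim/big_ind: _ => //; [exact: lspan0 | exact: lspanD].
Qed.

Lemma lspan_trans X Y v :
  (forall x, X x -> lspan Y x) -> lspan X v -> lspan Y v.
Proof.
move=> XY; elim=> [|a x y Xx _ IH]; first exact: lspan0.
by apply: lspanD => //; apply/lspanZ/XY.
Qed.

Lemma lspan_sub X Y v : (forall x, X x -> Y x) -> lspan X v -> lspan Y v.
Proof. by move=> XY; apply: lspan_trans => x /XY; exact: lspan_mem. Qed.

Lemma lspan_finP (I : finType) (g : I -> V) v :
  lspan (fun w => exists i, w = g i) v <->
  exists c : I -> K, v = \sum_i c i *: g i.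
Proof.
split=> [|[c ->]]; last first.
  by apply: lspan_sum => i _; apply/lspanZ/lspan_mem; exists i.
elim=> [|a x y [i ->] _ [c ->]].
  by exists (fun=> 0); rewrite big1 // => i _; rewrite scale0r.
exists (fun j => (j == i)%:R * a + c j).
under [RHS]eq_bigr do rewrite scalerDl.
rewrite big_split /=; congr (_ + _).
rewrite (bigD1 i) //= eqxx mul1r big1 ?addr0 // => j /negPf ->.
by rewrite mul0r scale0r.
Qed.

Lemma lspan_or X Y v :
  lspan (fun v => X v \/ Y v) v ->
  exists x y, [/\ lspan X x, lspan Y y & v = x + y].
Proof.
elim=> [|a v' w [Xv|Yv] _ [x [y [Xx Yy ->]]]].
- by exists 0, 0; split; [exact: lspan0|exact: lspan0|rewrite addr0].
- by exists (a *: v' + x), y; split=> //; [exact: lspan_cons|rewrite addrA].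
- by exists x, (a *: v' + y); split=> //; [exact: lspan_cons|rewrite addrCA].
Qed.

End LinearSpan.

Lemma lspan_mull (K : comNzRingType) (A : algType K) (a : A) (X Y : A -> Prop) v :
  (forall x, X x -> lspan Y (a * x)) -> lspan X v -> lspan Y (a * v).
Proof.
move=> XY; elim=> [|c x y Xx _ IH]; first by rewrite mulr0; exact: lspan0.
by rewrite mulrDr -scalerAr; apply: lspanD => //; apply/lspanZ/XY.
Qed.

Section FamilyRank.
Variable K : fieldType.

(** Full column rank: the rows [M i] span the space of all functions on [J]. *)
Definition spanning_rows (I J : finType) (M : I -> J -> K) :=
  forall j, exists u : I -> K, forall j', \sum_i u i * M i j' = (j == j')%:R.

(** [s] selects a row for each column; it may repeat rows, in which case the determinant is zero. *)
Definition minor (S : comPzRingType) (I J : finType) (M : I -> J -> S) (s : J -> I) :=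
  \det (\matrix_(i < #|J|, j < #|J|) M (s (enum_val i)) (enum_val j)).

Definition family_mx (S : Type) (I J : finType) (M : I -> J -> S) :=
  \matrix_(i < #|I|, j < #|J|) M (enum_val i) (enum_val j).

Lemma big_enum_val_fin (S : nmodType) (I : finType) (F : I -> S) :
  \sum_(i < #|I|) F (enum_val i) = \sum_i F i.
Proof.
rewrite (reindex (enum_val : 'I_#|I| -> I)) //=.
by exists enum_rank => i _; rewrite ?enum_valK ?enum_rankK.
Qed.

Lemma spanning_rowsP (I J : finType) (M : I -> J -> K) :
  spanning_rows M <-> row_full (family_mx M).
Proof.
split=> [fM|/row_fullP[B BM] j].
  apply/row_fullP.
  have /boolp.choice[u uP] : forall j, exists u : I -> K,
      forall j', \sum_i u i * M i j' = (j == j')%:R by exact: fM.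
  exists (\matrix_(j, i) u (enum_val j) (enum_val i)).
  apply/matrixP => j j'; rewrite !mxE.
  under eq_bigr do rewrite !mxE.
  rewrite (big_enum_val_fin (fun i => u (enum_val j) i * M i (enum_val j'))) uP.
  by rewrite (inj_eq enum_val_inj).
exists (fun i => B (enum_rank j) (enum_rank i)) => j'.
have := congr1 (fun A : 'M_#|J| => A (enum_rank j) (enum_rank j')) BM.
rewrite !mxE (inj_eq enum_rank_inj) => <-.
rewrite -big_enum_val_fin; apply: eq_bigr => i _.
by rewrite mxE enum_valK enum_rankK.
Qed.

(** Makes full rank an open condition, the nonvanishing of one of finitely many polynomials in the
    entries. Conversely, the inverse of a nonsingular submatrix, extended by zero, is a left
    inverse. *)
Lemma spanning_rows_minor (I J : finType) (M : I -> J -> K) :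
  spanning_rows M <-> exists s, minor M s != 0.
Proof.
split=> [/spanning_rowsP fM | [s sM]].
  exists (fun j => enum_val (fullrankfun fM (enum_rank j))).
  have := fullrowsub_unit fM; rewrite unitmxE unitfE; congr (\det _ != 0).
  by apply/matrixP => i j; rewrite !mxE enum_valK.
apply/spanning_rowsP/row_fullP; rewrite /minor in sM.
set A := (X in \det X) in sM.
have Au : A \in unitmx by rewrite unitmxE unitfE.
pose S : 'M[K]_(#|J|, #|I|) := \matrix_(j, i) (s (enum_val j) == enum_val i)%:R.
exists (invmx A *m S); rewrite -mulmxA.
suff -> : S *m family_mx M = A by rewrite mulVmx.
apply/matrixP => i j; rewrite !mxE.
under eq_bigr do rewrite !mxE.
rewrite (big_enum_val_fin (fun k => (s (enum_val i) == k)%:R * M k (enum_val j))).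
rewrite (bigD1 (s (enum_val i))) //= eqxx mul1r big1 ?addr0 // => k.
by rewrite eq_sym => /negPf ->; rewrite mul0r.
Qed.

(** The independent rows [N l] lie in the left kernel of a matrix of rank [#|J|]. *)
Lemma spanning_rows_card (I J L : finType) (M : I -> J -> K) (N : L -> I -> K) :
  spanning_rows M ->
  (forall l j, \sum_i N l i * M i j = 0) ->
  (forall w : L -> K, (forall i, \sum_l w l * N l i = 0) -> forall l, w l = 0) ->
  (#|J| + #|L| <= #|I|)%N.
Proof.
move=> /spanning_rowsP fM NM Nfree.
have NM0 : family_mx N *m family_mx M = 0.
  apply/matrixP => l j; rewrite !mxE; under eq_bigr do rewrite !mxE.
  by rewrite (big_enum_val_fin (fun i => N (enum_val l) i * M i (enum_val j))).
have fN : row_free (family_mx N).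
  rewrite -kermx_eq0; apply/eqP/row_matrixP => k; rewrite row0.
  set w := row k _.
  have wN : w *m family_mx N = 0.
    by rewrite -row_mul mulmx_ker row0.
  apply/rowP => l; rewrite [RHS]mxE.
  have := Nfree (fun l => w 0 (enum_rank l)); move/(_ _ (enum_val l)).
  rewrite enum_valK; apply=> i.
  have := congr1 (fun A : 'rV_#|I| => A 0 (enum_rank i)) wN.
  rewrite !mxE => E; rewrite -[RHS]E -big_enum_val_fin; apply: eq_bigr => l' _.
  by rewrite !mxE enum_valK enum_rankK.
have := mulmx0_rank_max NM0.
by move: fM fN => /eqP -> /eqP ->; rewrite addnC.
Qed.

End FamilyRank.

(** * Growth of the number of monomials *)

Section MonomialCount.

Lemma card_bmultinom_le (d s : nat) : (#|{: 'X_{1..d < s}}| <= s ^ d)%N.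
Proof.
have [->|s0] := posnP s.
  by rewrite (_ : #|_| = 0%N) //; apply: eq_card0 => -[m lt_m0]; have := lt_m0; rewrite ltn0.
rewrite -[s in (s ^ _)%N](card_ord s) -[d in (_ ^ d)%N](card_ord d) -card_ffun.
have lt_s (m : 'X_{1..d < s}) (i : 'I_d) : (m i < s)%N.
  apply: leq_ltn_trans (bmdeg m).
  by rewrite mdegE (bigD1 i) //= leq_addr.
apply: (@leq_card _ _ (fun m => [ffun i => Ordinal (lt_s m i)])) => m m' mm'.
apply/val_inj/mnmP => i.
by have /(congr1 val) := congr1 (fun f : {ffun 'I_d -> 'I_s} => f i) mm'; rewrite !ffunE.
Qed.

(** Bernoulli's inequality for the powers of 1 + 1/E, cleared of denominators. *)
Lemma bernoulli_nat (E k : nat) : (E ^ k * (E + k) <= E.+1 ^ k * E)%N.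
Proof.
elim: k => [|k IH]; first by rewrite !expn0 addn0.
rewrite !expnS; move: (E ^ k)%N (E.+1 ^ k)%N IH => a b; nia.
Qed.

Lemma leq_exp2r_weak (m n e : nat) : (m <= n)%N -> (m ^ e <= n ^ e)%N.
Proof. by case: e => // e; rewrite leq_exp2r. Qed.

(* Otherwise [c (t + delta) >= D / (D - 1) * c t] for all t, an exponential growth. *)
Lemma slow_growth (d D delta : nat) (c : nat -> nat) :
  (forall s, c s <= s ^ d)%N -> (forall s, 0 < s -> 0 < c s)%N ->
  exists t, (D * c (t + delta) < c (t + delta) + D * c t)%N.
Proof.
move=> c_le c_gt0; apply/not_existsP => H.
have {}H t : (c (t + delta) + D * c t <= D * c (t + delta))%N.
  by rewrite leqNgt; apply/negP/H.
case: D H => [|E] H; first by have := H 1%N; have := c_gt0 (1 + delta)%N; lia.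
have Hm m : (E.+1 ^ m * c 1 <= E ^ m * c (1 + m * delta))%N.
  elim: m => [|m IH]; first by rewrite !expn0 mul0n addn0.
  have /(leq_mul (leqnn (E ^ m))) := H (1 + m * delta)%N.
  have /(leq_mul (leqnn E.+1)) := IH.
  rewrite (_ : 1 + m.+1 * delta = 1 + m * delta + delta)%N; last by lia.
  by rewrite !expnS; nia.
have [E0|E0] := posnP E.
  by have := Hm 1%N; have := c_gt0 1%N; rewrite E0 expn1; lia.
(* After [E * q * d.+1] steps of length [delta], Bernoulli's inequality gives growth by a factor of
   at least [(1 + q) ^ d.+1], whereas the bound [s ^ d] allows at most [q * (1 + q) ^ d]; [A] is
   chosen for the latter. *)
pose A := (d.+1 * E * delta + 1)%N; pose q := (A ^ d)%N.
have Hk : (E ^ (E * q) * (1 + q) <= E.+1 ^ (E * q))%N.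
  by have := bernoulli_nat E (E * q); move: (E ^ _)%N (E.+1 ^ _)%N => a b; nia.
have {}Hk : (E ^ (E * q * d.+1) * (1 + q) ^ d.+1 <= E.+1 ^ (E * q * d.+1))%N.
  by rewrite (expnM E) (expnM E.+1) -expnMn leq_exp2r.
have := Hm (E * q * d.+1)%N.
have := c_le (1 + E * q * d.+1 * delta)%N.
have : ((1 + E * q * d.+1 * delta) ^ d <= q * (1 + q) ^ d)%N.
  rewrite -expnMn; apply: leq_exp2r_weak.
  rewrite (_ : E * q * d.+1 * delta = d.+1 * E * delta * q)%N; last by ring.
  by rewrite /A; rewrite mulnDr muln1 mulnDl mul1n; lia.
have := c_gt0 1%N isT; have Em : (0 < E ^ (E * q * d.+1))%N by rewrite expn_gt0 E0.
have : (0 < (1 + q) ^ d)%N by rewrite expn_gt0.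
move: Hk Em; rewrite [((1 + q) ^ d.+1)%N]expnS.
move: (E ^ _)%N (E.+1 ^ _)%N ((1 + q) ^ d)%N (c 1%N) (c _) (_ ^ d)%N => a b e f g h.
move=> ab a0 e0 f0 h_le g_le fb.
have : (a * ((1 + q) * e) <= a * (q * e))%N by nia.
by rewrite leq_pmul2l //; nia.
Qed.

End MonomialCount.

(** * Sparse and generic systems *)

Section BlockDegree.
Variables (C : fieldType) (d : nat) (B : finType) (b : 'I_d -> B).
Implicit Types (g h : {mpoly C[d]}) (m : 'X_{1..d}) (k : B -> nat).

Definition blockdeg (beta : B) (m : 'X_{1..d}) : nat :=
  (\sum_(l < d | b l == beta) m l)%N.

Lemma blockdegD beta m1 m2 :
  blockdeg beta (m1 + m2)%MM = (blockdeg beta m1 + blockdeg beta m2)%N.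
Proof. by rewrite -big_split /=; apply: eq_bigr => l _; rewrite mnmDE. Qed.

Lemma blockdeg0 beta : blockdeg beta 0%MM = 0%N.
Proof. by rewrite /blockdeg big1 // => l _; rewrite mnm0E. Qed.

Lemma blockdegU beta l : blockdeg beta U_(l)%MM = (b l == beta) :> nat.
Proof.
rewrite /blockdeg big_mkcond (bigD1 l) //= big1 ?addn0 => [|i il].
  by rewrite mnm1E eqxx; case: ifP.
by rewrite mnm1E; case: (l =P i) il => [->|_ _]; [rewrite eqxx|case: ifP].
Qed.

Lemma mdeg_blockdeg m : mdeg m = (\sum_beta blockdeg beta m)%N.
Proof. by rewrite mdegE (partition_big b xpredT). Qed.

Lemma leq_blockdeg beta m : (blockdeg beta m <= mdeg m)%N.
Proof. by rewrite mdeg_blockdeg (bigD1 beta) //= leq_addr. Qed.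

Definition bdeg k g := forall m, g@_m != 0 -> forall beta, (blockdeg beta m <= k beta)%N.

Lemma bdegW k k' g : (forall beta, (k beta <= k' beta)%N) -> bdeg k g -> bdeg k' g.
Proof. by move=> kk' gk m gm beta; apply: leq_trans (kk' beta); exact: gk. Qed.

Lemma bdeg0 k : bdeg k 0.
Proof. by move=> m; rewrite mcoeff0 eqxx. Qed.

Lemma bdegD k g h : bdeg k g -> bdeg k h -> bdeg k (g + h).
Proof.
move=> gk hk m; rewrite mcoeffD => ghm.
have [gm0|gm] := eqVneq g@_m 0; last exact: gk.
by apply: hk; move: ghm; rewrite gm0 add0r.
Qed.

Lemma bdegZ k a g : bdeg k g -> bdeg k (a *: g).
Proof.
move=> gk m; rewrite mcoeffZ => agm; apply: gk.
by apply: contraNneq agm => ->; rewrite mulr0.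
Qed.

Lemma bdegB k g h : bdeg k g -> bdeg k h -> bdeg k (g - h).
Proof. by move=> gk hk; rewrite -scaleN1r; apply/bdegD/bdegZ. Qed.

Lemma bdeg_sum k (I : Type) (r : seq I) (P : pred I) (F : I -> {mpoly C[d]}) :
  (forall i, P i -> bdeg k (F i)) -> bdeg k (\sum_(i <- r | P i) F i).
Proof.
by move=> FP; elim/big_ind: _ => //; [exact: bdeg0 | exact: bdegD].
Qed.

Lemma bdegX k m : (forall beta, blockdeg beta m <= k beta)%N -> bdeg k 'X_[m].
Proof.
by move=> mk m'; rewrite mcoeffX; have [<-|] := eqVneq m m'; rewrite ?eqxx.
Qed.

Lemma bdegC k c : bdeg k c%:MP.
Proof.
rewrite -[c%:MP]mulr1 mul_mpolyC -[X in _ *: X](mpolyX0 d).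
by apply/bdegZ/bdegX => beta; rewrite blockdeg0.
Qed.

Lemma bdeg1 k : bdeg k 1.
Proof. by rewrite -mpolyC1; exact: bdegC. Qed.

Lemma bdegM k1 k2 g h :
  bdeg k1 g -> bdeg k2 h -> bdeg (fun beta => k1 beta + k2 beta)%N (g * h).
Proof.
move=> gk hk m; rewrite -mcoeff_msupp => /msuppM_le.
case/allpairsP => -[m1 m2] /=; rewrite !mcoeff_msupp => -[gm1 hm2 ->] beta.
by rewrite blockdegD leq_add ?gk ?hk.
Qed.

Lemma bdegXn k g n : bdeg k g -> bdeg (fun beta => n * k beta)%N (g ^+ n).
Proof.
move=> gk; elim: n => [|n IH]; first exact: bdeg1.
rewrite exprS; apply: bdegW (bdegM gk IH) => beta.
by rewrite mulSn.
Qed.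

Lemma bdeg_prod (I : Type) (r : seq I) (P : pred I) (k : I -> B -> nat)
    (F : I -> {mpoly C[d]}) :
  (forall i, P i -> bdeg (k i) (F i)) ->
  bdeg (fun beta => \sum_(i <- r | P i) k i beta)%N (\prod_(i <- r | P i) F i).
Proof.
move=> Fk; elim: r => [|i r IH]; first by rewrite big_nil; exact: bdeg1.
rewrite big_cons; case: ifP => Pi.
  by apply: bdegW (bdegM (Fk i Pi) IH) => beta; rewrite big_cons Pi.
by apply: bdegW IH => beta; rewrite big_cons Pi.
Qed.

Lemma bdeg_det n k (A : 'M[{mpoly C[d]}]_n) :
  (forall i j, bdeg k (A i j)) -> bdeg (fun beta => n * k beta)%N (\det A).
Proof.
move=> Ak; apply: bdeg_sum => s _; rewrite -signr_odd.
have H : bdeg (fun beta => n * k beta)%N (\prod_i A i (s i)).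
  have := @bdeg_prod _ (index_enum 'I_n) xpredT (fun=> k) _ (fun i _ => Ak i (s i)).
  by apply: bdegW => beta; rewrite sum_nat_const card_ord.
by case: odd; rewrite ?mul1r // mulN1r -scaleN1r; exact: bdegZ.
Qed.

Lemma bdeg_mderiv k g l : bdeg k g -> bdeg k g^`M(l).
Proof.
move=> gk m; rewrite mcoeff_deriv => gm beta.
apply: leq_trans (gk (m + U_(l))%MM _ beta); first by rewrite blockdegD leq_addr.
by apply: contraNneq gm => ->; rewrite mul0rn.
Qed.

Lemma bdeg_msize g : bdeg (fun=> msize g) g.
Proof.
move=> m; rewrite -mcoeff_msupp => /msize_mdeg_lt /ltnW mg beta.
exact: leq_trans (leq_blockdeg _ _) mg.
Qed.

(** One more than the largest total degree, because ['X_{1..d < n}] bounds degrees strictly; it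
    places the monomials of block degree at most [k] in a finite type. *)
Definition degbound k : nat := (\sum_beta k beta)%N.+1.

Lemma mdeg_degbound k m :
  (forall beta, blockdeg beta m <= k beta)%N -> (mdeg m < degbound k)%N.
Proof. by move=> mk; rewrite ltnS mdeg_blockdeg; apply: leq_sum => beta _. Qed.

Lemma bdeg_lspan k g : bdeg k g ->
  lspan (fun v => exists2 m, (forall beta, blockdeg beta m <= k beta)%N & v = 'X_[m]) g.
Proof.
move=> gk; rewrite [g]mpolyE big_seq; apply: lspan_sum => m mg.
apply/lspanZ/lspan_mem; exists m => // beta; apply: gk.
by rewrite -mcoeff_msupp.
Qed.

End BlockDegree.

Section Sparse.
Variables (C : numClosedFieldType) (d : nat) (B : finType) (b : 'I_d -> B).
Variable chi : 'I_d -> pred B.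
Implicit Types (f : 'I_d -> {mpoly C[d]}) (g h : {mpoly C[d]}) (m : 'X_{1..d}).
Implicit Types (k : B -> nat).
Local Notation bdeg := (bdeg b).
Local Notation system := ('I_d -> {mpoly C[d]}).

(** [chi j] is the set of blocks allowed in equation [j]. Block degree at most 1 in these and 0 in
    the others encodes squarefreeness, linearity in each block and the edge condition at once. *)
Definition sparse f := forall j, bdeg (fun beta => chi j beta) (f j).

(* The products [f j * h] of block degree at most k, as bounded by the degrees
   of [h] and the sparsity of [f]. *)
Definition ideal_gen f k (v : {mpoly C[d]}) :=
  exists j h k', [/\ bdeg k' h, forall beta, (k' beta + chi j beta <= k beta)%N
                   & v = f j * h].

(** The degree bound on the multiples of the equations keeps this a statement about finitely many
    coefficients, so that it can be transferred to generic systems. *)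
Definition spans_at (I : Type) (E : I -> {mpoly C[d]}) f k :=
  forall g, bdeg k g -> lspan (fun v => (exists i, v = E i) \/ ideal_gen f k v) g.

Definition polyfun (phi : system -> C) :=
  exists H : {mpoly C[#|{: 'I_d * {set 'I_d}}|]},
    forall f, sparse f -> phi f = H.@[coefficients f].

(** [for_generic_coefficients] with sparsity expressed by block degrees. *)
Definition generic (Q : system -> Prop) :=
  exists H : {mpoly C[#|{: 'I_d * {set 'I_d}}|]},
    (exists2 f, sparse f & H.@[coefficients f] != 0) /\
    (forall f, sparse f -> H.@[coefficients f] != 0 -> Q f).

Lemma polyfun_const c : polyfun (fun=> c).
Proof. by exists c%:MP => f _; rewrite mevalC. Qed.

Lemma polyfunD phi psi :
  polyfun phi -> polyfun psi -> polyfun (fun f => phi f + psi f).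
Proof.
by move=> [H Hphi] [H' Hpsi]; exists (H + H') => f sf; rewrite mevalD -Hphi -?Hpsi.
Qed.

Lemma polyfunM phi psi :
  polyfun phi -> polyfun psi -> polyfun (fun f => phi f * psi f).
Proof.
by move=> [H Hphi] [H' Hpsi]; exists (H * H') => f sf; rewrite mevalM -Hphi -?Hpsi.
Qed.

Lemma polyfun_ext phi psi :
  (forall f, sparse f -> phi f = psi f) -> polyfun phi -> polyfun psi.
Proof. by move=> phi_psi [H Hphi]; exists H => f sf; rewrite -phi_psi // Hphi. Qed.

Lemma polyfun_sum (I : Type) (r : seq I) (P : pred I) (F : I -> system -> C) :
  (forall i, polyfun (F i)) -> polyfun (fun f => \sum_(i <- r | P i) F i f).
Proof.
move=> FP; elim: r => [|i r IH].
  by apply: polyfun_ext (polyfun_const 0) => f _; rewrite big_nil.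
case Pi: (P i); last by apply: polyfun_ext IH => f _; rewrite big_cons Pi.
by apply: polyfun_ext (polyfunD (FP i) IH) => f _; rewrite big_cons Pi.
Qed.

Lemma polyfun_prod (I : Type) (r : seq I) (P : pred I) (F : I -> system -> C) :
  (forall i, polyfun (F i)) -> polyfun (fun f => \prod_(i <- r | P i) F i f).
Proof.
move=> FP; elim: r => [|i r IH].
  by apply: polyfun_ext (polyfun_const 1) => f _; rewrite big_nil.
case Pi: (P i); last by apply: polyfun_ext IH => f _; rewrite big_cons Pi.
by apply: polyfun_ext (polyfunM (FP i) IH) => f _; rewrite big_cons Pi.
Qed.

Lemma sparse_le1 f j m l : sparse f -> (f j)@_m != 0 -> (m l <= 1)%N.
Proof.
move=> sf /sf /(_ (b l)); rewrite /blockdeg (bigD1 l) //= => H.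
by apply: leq_trans (leq_b1 (chi j (b l))); apply: leq_trans H; exact: leq_addr.
Qed.

(** Coefficients of squarefree monomials are entries of [coefficients f]; all others vanish for
    sparse [f]. *)
Lemma polyfun_coeff j m : polyfun (fun f => (f j)@_m).
Proof.
have [m1|m1] := boolP [forall l, m l <= 1]%N; last first.
  exists 0 => f sf; rewrite meval0; apply/eqP; apply: contraNT m1 => fm.
  by apply/forallP => l; exact: sparse_le1 fm.
exists 'X_(enum_rank (j, [set l | m l != 0%N]%SET)) => f sf.
rewrite mevalXU /coefficients enum_rankK /=; congr (_@__).
apply/mnmP => l; rewrite mnmE inE.
by have := forallP m1 l; case: (m l) => [|[|]].
Qed.

Definition poly_family (F : system -> {mpoly C[d]}) :=
  forall m, polyfun (fun f => (F f)@_m).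

Lemma poly_family_const g : poly_family (fun=> g).
Proof. by move=> m; exact: polyfun_const. Qed.

Lemma poly_family_id j : poly_family (fun f => f j).
Proof. exact: polyfun_coeff. Qed.

Lemma poly_family_sum (I : Type) (r : seq I) (P : pred I)
    (F : I -> system -> {mpoly C[d]}) :
  (forall i, poly_family (F i)) -> poly_family (fun f => \sum_(i <- r | P i) F i f).
Proof.
move=> FP m; have := polyfun_sum r P (fun i => FP i m).
by apply: polyfun_ext => f _; rewrite raddf_sum.
Qed.

Lemma poly_familyM F F' :
  poly_family F -> poly_family F' -> poly_family (fun f => F f * F' f).
Proof.
move=> FP FP' m.
apply: (@polyfun_ext (fun f => \sum_(k : 'X_{1..d < (mdeg m).+1, (mdeg m).+1}
   | m == (k.1 + k.2)%MM) (F f)@_k.1 * (F' f)@_k.2)).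
  by move=> f _; rewrite mcoeffM.
by apply: polyfun_sum => k; apply: polyfunM.
Qed.

Lemma poly_family_prod (I : Type) (r : seq I) (P : pred I)
    (F : I -> system -> {mpoly C[d]}) :
  (forall i, poly_family (F i)) -> poly_family (fun f => \prod_(i <- r | P i) F i f).
Proof.
move=> FP; elim: r => [|i r IH].
  move=> m; apply: polyfun_ext (poly_family_const 1 m) => f _; by rewrite big_nil.
case Pi: (P i) => m.
  by apply: polyfun_ext (poly_familyM (FP i) IH m) => f _; rewrite big_cons Pi.
by apply: polyfun_ext (IH m) => f _; rewrite big_cons Pi.
Qed.

Lemma poly_familyXn n F : poly_family F -> poly_family (fun f => F f ^+ n).
Proof.
move=> FP m; have := poly_family_prod (index_enum 'I_n) xpredT (fun=> FP) m.
by apply: polyfun_ext => f _; rewrite prodr_const card_ord.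
Qed.

Lemma poly_family_mderiv l F : poly_family F -> poly_family (fun f => (F f)^`M(l)).
Proof.
move=> FP m.
have := polyfunM (polyfun_const (m l).+1%:R) (FP (m + U_(l))%MM).
by apply: polyfun_ext => f _; rewrite mcoeff_deriv mulr_natl.
Qed.

Lemma poly_family_det n (F : 'I_n -> 'I_n -> system -> {mpoly C[d]}) :
  (forall i j, poly_family (F i j)) ->
  poly_family (fun f => \det (\matrix_(i, j) F i j f)).
Proof.
move=> FP m.
have := @poly_family_sum _ (index_enum {perm 'I_n}) xpredT
  (fun s f => (-1) ^+ s * \prod_i F i (s i) f).
move=> /(_ _ m) HP; apply: polyfun_ext (HP _) => [f _|s].
  congr (_@__); apply: eq_bigr => s _; congr (_ * _).
  by apply: eq_bigr => i _; rewrite mxE.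
by apply: poly_familyM (poly_family_const _) (poly_family_prod _ _ _).
Qed.

Lemma polyfun_det n (F : 'I_n -> 'I_n -> system -> C) :
  (forall i j, polyfun (F i j)) ->
  polyfun (fun f => \det (\matrix_(i, j) F i j f)).
Proof.
move=> FP.
have := @polyfun_sum _ (index_enum {perm 'I_n}) xpredT
  (fun s f => (-1) ^+ s * \prod_i F i (s i) f).
move=> HP; apply: polyfun_ext (HP _) => [f _|s].
  apply: eq_bigr => s _; congr (_ * _).
  by apply: eq_bigr => i _; rewrite mxE.
by apply: polyfunM (polyfun_const _) (polyfun_prod _ _ _).
Qed.

(** A minor that is nonzero at [f0] serves as the polynomial off whose zero locus the property
    holds. *)
Lemma generic_spanning_rows (I J : finType) (M : I -> J -> system -> C) f0 :
  sparse f0 -> (forall i j, polyfun (M i j)) ->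
  spanning_rows (fun i j => M i j f0) ->
  generic (fun f => spanning_rows (fun i j => M i j f)).
Proof.
move=> sf0 MP /spanning_rows_minor[s s0].
have [H HP] : polyfun (fun f => minor (fun i j => M i j f) s).
  by apply: polyfun_det => i j; exact: MP.
exists H; split; first by exists f0; rewrite // -HP.
by move=> f sf; rewrite -HP // => fs; apply/spanning_rows_minor; exists s.
Qed.

Lemma sparse_line f f' t :
  sparse f -> sparse f' -> sparse (fun j => f j + t *: (f' j - f j)).
Proof. by move=> sf sg j; apply: bdegD => //; apply/bdegZ/bdegB. Qed.

Lemma meval_line n (v w : 'I_n -> C) (H : {mpoly C[n]}) :
  exists q : {poly C}, forall t, q.[t] = H.@[fun i => v i + t * w i].
Proof.
exists (\sum_(m <- msupp H) H@_m *: \prod_i ((v i)%:P + w i *: 'X) ^+ m i) => t.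
rewrite horner_sum mevalE; apply: eq_bigr => m _.
rewrite hornerZ horner_prod; congr (_ * _); apply: eq_bigr => i _.
by rewrite horner_exp !hornerE mulrC.
Qed.

Lemma poly_nonroot (q : {poly C}) : q != 0 -> exists t, q.[t] != 0.
Proof.
move=> q0; apply/not_existsP => H.
have qt t : root q t by rewrite /root; apply/negPn/negP/H.
have := @max_poly_roots _ q [seq i%:R | i <- iota 0 (size q)] q0.
rewrite size_map size_iota ltnn => H'; suff: false by []; apply: H'.
  by apply/allP => t _; exact: qt.
by rewrite map_inj_uniq ?iota_uniq // => i j /eqP; rewrite eqr_nat => /eqP.
Qed.

(* On the line joining a system where H is nonzero to one where H' is nonzero,
   both are nonzero univariate polynomials. *)
Lemma generic_and Q Q' : generic Q -> generic Q' -> generic (fun f => Q f /\ Q' f).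
Proof.
move=> [H [[f sf Hf] HQ]] [H' [[f' sf' Hf'] HQ']].
exists (H * H'); split; last first.
  by move=> g sg; rewrite mevalM mulf_eq0 negb_or => /andP[? ?]; split; auto.
have cE t : coefficients (fun j => f j + t *: (f' j - f j)) =
    (fun i => coefficients f i + t * (coefficients f' i - coefficients f i)).
  by apply/funext => i; rewrite /coefficients mcoeffD mcoeffZ mcoeffB.
have [q qP] := meval_line (coefficients f)
  (fun i => coefficients f' i - coefficients f i) H.
have [q' qP'] := meval_line (coefficients f)
  (fun i => coefficients f' i - coefficients f i) H'.
have q0 : q != 0.
  apply: contraNneq Hf => q0; apply/eqP; have := qP 0; rewrite q0 horner0 => ->.
  by apply: meval_eq => i; rewrite mul0r addr0.
have q'0 : q' != 0.
  apply: contraNneq Hf' => q0'; apply/eqP; have := qP' 1; rewrite q0' horner0 => ->.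
  by apply: meval_eq => i; rewrite mul1r addrC subrK.
have [|t] := @poly_nonroot (q * q'); first by rewrite mulf_neq0.
rewrite hornerM qP qP' -cE -mevalM => tP.
by exists (fun j => f j + t *: (f' j - f j)) => //; exact: sparse_line.
Qed.

Lemma generic_imp (Q Q' : system -> Prop) :
  (forall f, sparse f -> Q f -> Q' f) -> generic Q -> generic Q'.
Proof.
by move=> QQ' [H [Hf HQ]]; exists H; split=> // f sf fH; apply: QQ' => //; exact: HQ.
Qed.

Lemma generic_ex Q : generic Q -> exists2 f, sparse f & Q f.
Proof. by move=> [H [[f sf Hf] HQ]]; exists f => //; exact: HQ. Qed.

End Sparse.

(** * Cramer's rule and jets *)

Section Cramer.
Variables (C : fieldType) (d : nat).
Implicit Types (g h : {mpoly C[d]}).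

(* The total degree is the block degree for a single block. *)
Definition mdeg_le (N : nat) g := bdeg (fun=> tt) (fun=> N) g.

Lemma mdeg_leP N g : mdeg_le N g <-> (forall m, g@_m != 0 -> (mdeg m <= N)%N).
Proof.
have E (m : 'X_{1..d}) beta : blockdeg (fun=> tt : unit) beta m = mdeg m.
  by case: beta; rewrite mdegE; apply: eq_bigl => l; rewrite eqxx.
split=> gN m gm; first by rewrite -(E m tt); exact: gN.
by move=> beta; rewrite E gN.
Qed.

Lemma mdeg_leW N N' g : (N <= N')%N -> mdeg_le N g -> mdeg_le N' g.
Proof. by move=> NN'; exact: bdegW. Qed.

Lemma mdeg_le_det n (A : 'M[{mpoly C[d]}]_n) :
  (forall i j, mdeg_le 1 (A i j)) -> mdeg_le n (\det A).
Proof. by move=> A1; have := bdeg_det A1; apply: bdegW => beta; rewrite muln1. Qed.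

Lemma mdeg_le_adj n (A : 'M[{mpoly C[d]}]_n) i j :
  (forall i j, mdeg_le 1 (A i j)) -> mdeg_le n (\adj A i j).
Proof.
move=> A1; rewrite mxE /cofactor -signr_odd.
have H : mdeg_le n (\det (row' j (col' i A))).
  apply: (mdeg_leW (leq_pred n)); apply: mdeg_le_det => i' j'.
  by rewrite !mxE.
by case: odd; rewrite ?mul1r // mulN1r -scaleN1r; exact: bdegZ.
Qed.

(** [Delta] is a minor, and [Q] comes from the adjugate of the corresponding submatrix. The constant
    term of [Delta] is the same minor of the constant terms, hence nonzero for a suitable choice of
    rows. *)
Lemma cramer_family (I J : finType) (M : I -> J -> {mpoly C[d]}) :
  (forall i j, mdeg_le 1 (M i j)) ->
  spanning_rows (fun i j => (M i j)@_0) ->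
  exists (Delta : {mpoly C[d]}) (Q : J -> I -> {mpoly C[d]}),
    [/\ Delta != 0, mdeg_le #|J| Delta, forall j i, mdeg_le #|J| (Q j i)
      & forall j j', \sum_i Q j i * M i j' = Delta * (j == j')%:R].
Proof.
move=> M1 /spanning_rows_minor[s s0].
pose A := \matrix_(i < #|J|, j < #|J|) M (s (enum_val i)) (enum_val j).
have A1 i j : mdeg_le 1 (A i j) by rewrite mxE.
pose Q j i := \sum_t \adj A (enum_rank j) t * (s (enum_val t) == i)%:R.
exists (\det A), Q; split=> [||j i|j j'].
- apply: contraNneq s0 => A0; apply/eqP.
  transitivity (mcoeff 0%MM (\det A)); last by rewrite A0 mcoeff0.
  rewrite -det_map_mx /minor; congr (\det _).
  by apply/matrixP => i j; rewrite !mxE.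
- exact: mdeg_le_det.
- apply: bdeg_sum => t _; case: eqP => _; rewrite ?mulr0 ?mulr1; last exact: bdeg0.
  exact: mdeg_le_adj.
- have <- : (\adj A *m A) (enum_rank j) (enum_rank j') = \det A * (j == j')%:R.
    by rewrite mul_adj_mx mxE (inj_eq enum_rank_inj) mulr_natr.
  rewrite mxE.
  under eq_bigr do rewrite mulr_suml.
  rewrite exchange_big /=; apply: eq_bigr => t _.
  rewrite [A _ _]mxE enum_rankK (bigD1 (s (enum_val t))) //= eqxx mulr1.
  by rewrite big1 ?addr0 // => i /negPf; rewrite eq_sym => ->; rewrite mulr0 mul0r.
Qed.

End Cramer.

Section Jets.
Variables (C : fieldType) (d : nat).
Implicit Types (g h : {mpoly C[d]}) (z : 'I_d -> C).

(** The polynomial g(x + z); its coefficients are those of the Taylor expansion of [g] at [z]. *)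
Definition shift z g : {mpoly C[d]} :=
  mmap (@mpolyC d C) (fun l => 'X_l + (z l)%:MP) g.

HB.instance Definition _ z := GRing.RMorphism.copy (shift z)
  (mmap (@mpolyC d C) (fun l => 'X_l + (z l)%:MP)).

Lemma shiftC z c : shift z c%:MP = c%:MP.
Proof. exact: mmapC. Qed.

Lemma shiftZ z c g : shift z (c *: g) = c *: shift z g.
Proof. by rewrite -!mul_mpolyC rmorphM /= shiftC. Qed.

Lemma shiftXU z l : shift z 'X_l = 'X_l + (z l)%:MP.
Proof. by rewrite /shift mmapX mmap1U. Qed.

Lemma shift_coeff0 z g : (shift z g)@_0 = g.@[z].
Proof.
rewrite /shift /mmap raddf_sum mevalE; apply: eq_bigr => m _ /=.
rewrite mul_mpolyC mcoeffZ; congr (_ * _); rewrite /mmap1 rmorph_prod.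
apply: eq_bigr => l _; rewrite rmorphXn /= mcoeffD mcoeffC eqxx mulr1.
by rewrite mcoeffX mnm1_eq0 add0r.
Qed.

Definition vanishes_to (s : nat) g := forall m, (mdeg m < s)%N -> g@_m = 0.

Lemma vanishes_toM s t g h :
  vanishes_to s g -> vanishes_to t h -> vanishes_to (s + t) (g * h).
Proof.
move=> gs ht m lt_m; rewrite mcoeffM big1 // => -[m1 m2] /= /eqP/(congr1 (@mdeg d)); rewrite mdegD => mE.
have [lt1|le1] := ltnP (mdeg m1) s; first by rewrite gs ?mul0r.
rewrite ht ?mulr0 //; lia.
Qed.

Lemma vanishes_to0 g : vanishes_to 0 g.
Proof. by move=> m; rewrite ltn0. Qed.

Lemma vanishes_toMl s g h : vanishes_to s g -> vanishes_to s (g * h).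
Proof. by move=> gs; rewrite -[s]addn0; apply: vanishes_toM => //; exact: vanishes_to0. Qed.

Lemma vanishes_toXn s g : vanishes_to 1 g -> vanishes_to s (g ^+ s).
Proof.
move=> g1; elim: s => [|s IH]; first exact: vanishes_to0.
by rewrite exprS -add1n; exact: vanishes_toM.
Qed.

Lemma vanishes_to1 g : vanishes_to 1 g <-> g@_0 = 0.
Proof.
split=> [H|g0 m]; first by apply: H; rewrite mdeg0.
by rewrite ltnS leqn0 mdeg_eq0 => /eqP ->.
Qed.

(** An explicit Chinese remainder argument: with [w] equal to 1 at [z i] and 0 at the other points,
    [a = 1 - (1 - w ^+ s) ^+ s] agrees to order [s] with 1 at [z i] and with 0 at the other points.
    Multiplying [a] by a monomial centred at [z i] yields the jet. *)
Lemma jets_surjective n (z : 'I_n -> 'I_d -> C) s i (beta : 'X_{1..d}) :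
  injective z -> (mdeg beta < s)%N ->
  exists g, forall i' beta', (mdeg beta' < s)%N ->
    (shift (z i') g)@_beta' = ((i == i') && (beta == beta'))%:R.
Proof.
move=> z_inj beta_s.
have /boolp.choice[p pP] : forall i', exists p : {mpoly C[d]},
    i != i' -> p.@[z i] = 1 /\ p.@[z i'] = 0.
  move=> i'; have [->|ii'] := eqVneq i i'; first by exists 0.
  have /existsNP[l /eqP zl] : ~ forall l, z i l = z i' l.
    by move=> /funext /z_inj /eqP; rewrite (negPf ii').
  exists ((z i l - z i' l)^-1 *: ('X_l - (z i' l)%:MP)) => _.
  rewrite !mevalZ !mevalB !mevalXU !mevalC subrr mulr0 mulVf //.
  by rewrite subr_eq0.
pose w := \prod_(i' | i != i') p i'; pose a := 1 - (1 - w ^+ s) ^+ s.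
exists (a * \prod_l ('X_l - (z i l)%:MP) ^+ beta l) => i' beta' beta's.
rewrite rmorphM; have [<-|ii'] /= := eqVneq i i'; last first.
  suff /vanishes_toMl-> : vanishes_to s (shift (z i') a) by [].
  have ws : vanishes_to s (shift (z i') (w ^+ s)).
    rewrite rmorphXn; apply/vanishes_toXn/vanishes_to1; rewrite shift_coeff0.
    rewrite rmorph_prod /= (bigD1 i') //=.
    by have [_ ->] := pP _ ii'; rewrite mul0r.
  have -> : a = w ^+ s * \sum_(t < s) (1 - w ^+ s) ^+ t.
    by rewrite /a -opprB subrX1 addrAC subrr add0r mulNr opprK.
  by rewrite rmorphM /=; exact: vanishes_toMl.
have -> : shift (z i) (\prod_l ('X_l - (z i l)%:MP) ^+ beta l) = 'X_[beta].
  rewrite rmorph_prod mpolyXE_id; apply: eq_bigr => l _.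
  by rewrite rmorphXn /= rmorphB /= shiftXU shiftC addrK.
rewrite /a rmorphB rmorph1 /= mulrBl mul1r mcoeffB mcoeffX.
have -> : (shift (z i) ((1 - w ^+ s) ^+ s) * 'X_[beta])@_beta' = 0.
  apply: vanishes_toMl beta's; rewrite rmorphXn; apply/vanishes_toXn/vanishes_to1.
  rewrite shift_coeff0 mevalB meval1 rmorphXn rmorph_prod /= big1 ?expr1n ?subrr //.
  by move=> j /pP[].
by rewrite subr0.
Qed.

End Jets.

(** * Bound for the number of points of a finite fibre *)

Section FiberBound.
Variables (C : numClosedFieldType) (d : nat) (B : finType) (b : 'I_d -> B).
Variable chi : 'I_d -> pred B.
Implicit Types (f : 'I_d -> {mpoly C[d]}) (g h : {mpoly C[d]}) (m : 'X_{1..d}).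
Implicit Types (k : B -> nat).
Local Notation bdeg := (bdeg b).
Local Notation blockdeg := (blockdeg b).
Local Notation system := ('I_d -> {mpoly C[d]}).
Local Notation sparse := (sparse b chi).
Local Notation spans_at := (spans_at b chi).
Local Notation generic := (generic b chi).
Local Notation polyfun := (polyfun b chi).
Local Notation poly_family := (poly_family b chi).

(** The monomial basis of the polynomials of block degree at most [k], as a finite type that can
    index the columns of a matrix. *)
Definition low_mnm k := {m : 'X_{1..d < degbound k} | [forall beta, (blockdeg beta m <= k beta)%N]}.

(** A finite family with the same span as the generators in [spans_at]; a product exceeding the
    degree bound is replaced by 0. *)
Definition gens (I : finType) (E : I -> {mpoly C[d]}) f k
    (i : I + 'I_d * 'X_{1..d < degbound k}) : {mpoly C[d]} :=
  match i with
  | inl i => E i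
  | inr (j, m) => if [forall beta, (blockdeg beta m + chi j beta <= k beta)%N]
                  then f j * 'X_[m] else 0
  end.

Arguments gens [I] E f k i.

Lemma low_mnm_ex k m :
  (forall beta, (blockdeg beta m <= k beta)%N) -> exists t : low_mnm k, val (val t) = m.
Proof.
move=> mk; have mP : [forall beta, (blockdeg beta m <= k beta)%N] by apply/forallP.
by exists (exist _ (BMultinom (mdeg_degbound mk)) mP).
Qed.

Lemma low_mnmP k (t : low_mnm k) beta : (blockdeg beta (val (val t)) <= k beta)%N.
Proof. by case: t => t /= /forallP. Qed.

Lemma low_mnm_inj k (t t' : low_mnm k) : val (val t) = val (val t') -> t = t'.
Proof. by move=> /val_inj/val_inj. Qed.

Lemma bdeg_low_mnm k g : bdeg k g -> g = \sum_(t : low_mnm k) g@_(val (val t)) *: 'X_[val (val t)].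
Proof.
move=> gk; apply/mpolyP => m; rewrite raddf_sum /=.
under eq_bigr do rewrite mcoeffZ mcoeffX.
have [gm0|gm] := eqVneq g@_m 0.
  rewrite gm0 big1 // => t _; case: eqP => [->|]; by rewrite ?gm0 ?mul0r ?mulr0.
have [t tm] := low_mnm_ex (gk m gm).
rewrite (bigD1 t) //= tm eqxx mulr1 big1 ?addr0 // => t' tt'.
case: eqP => [E|]; last by rewrite mulr0.
by case/eqP: tt'; apply: low_mnm_inj; rewrite tm.
Qed.

Lemma bdeg_gens (I : finType) (E : I -> {mpoly C[d]}) f k i :
  sparse f -> (forall i, bdeg k (E i)) -> bdeg k (gens E f k i).
Proof.
move=> sf Ek; case: i => [i|[j m]] /=; first exact: Ek.
case: ifP => [/forallP mk|_]; last exact: bdeg0.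
have mX : bdeg (fun beta => blockdeg beta m) ('X_[m] : {mpoly C[d]}) by exact: bdegX.
by apply: bdegW (bdegM (sf j) mX) => beta; rewrite addnC.
Qed.

Lemma spans_at_gens (I : finType) (E : I -> {mpoly C[d]}) f k :
  spans_at E f k <->
  (forall g, bdeg k g -> lspan (fun v => exists i, v = gens E f k i) g).
Proof.
split=> H g gk; apply: lspan_trans (H g gk) => v.
  case=> [[i ->]|[j [h [k' [hk' kk' ->]]]]]; first by apply: lspan_mem; exists (inl i).
  apply: lspan_mull (bdeg_lspan hk') => _ [m mk' ->].
  have mk beta : (blockdeg beta m + chi j beta <= k beta)%N.
    by apply: leq_trans (kk' beta); rewrite leq_add2r.
  have mk0 beta : (blockdeg beta m <= k beta)%N.
    by apply: leq_trans (mk beta); rewrite leq_addr.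
  apply: lspan_mem; exists (inr (j, BMultinom (mdeg_degbound mk0))) => /=.
  by case: ifP => // /forallP[].
case=> -[i ->|[j m] -> /=]; first by apply: lspan_mem; left; exists i.
case: ifP => [/forallP mk|_]; last exact: lspan0.
apply: lspan_mem; right; exists j, 'X_[m], (fun beta => blockdeg beta m).
by split=> //; exact: bdegX.
Qed.

(** Writing the generators in the monomial basis turns the spanning property into full column rank
    of their coefficient matrix. *)
Lemma spans_atP (I : finType) (E : I -> {mpoly C[d]}) f k :
  sparse f -> (forall i, bdeg k (E i)) ->
  spans_at E f k <->
  spanning_rows (fun i (t : low_mnm k) => (gens E f k i)@_(val (val t))).
Proof.
move=> sf Ek; rewrite spans_at_gens; split=> [H t|H g gk].
  have /lspan_finP[u uP] := H 'X_[val (val t)] (bdegX (low_mnmP t)).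
  exists u => t'; transitivity ('X_[C, val (val t)]@_(val (val t'))).
    by rewrite uP raddf_sum; apply: eq_bigr => i _ /=; rewrite mcoeffZ.
  by rewrite mcoeffX; congr (nat_of_bool _)%:R; apply/eqP/eqP => [/low_mnm_inj|->].
rewrite (bdeg_low_mnm gk); apply: lspan_sum => t _; apply: lspanZ.
have [u uP] := H t; apply/lspan_finP; exists u.
rewrite [RHS](@bdeg_low_mnm k); last by apply: bdeg_sum => i _; exact/bdegZ/bdeg_gens.
rewrite [LHS](bdeg_low_mnm (bdegX (low_mnmP t))).
apply: eq_bigr => t' _; congr (_ *: _); rewrite raddf_sum mcoeffX /=.
rewrite (_ : _ == _ = (t == t')) -?uP; last first.
  by apply/eqP/eqP => [/low_mnm_inj|->].
by apply: eq_bigr => i _; rewrite mcoeffZ.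
Qed.

(** The coefficient matrix depends polynomially on [f], so spanning persists from one system [f0] to
    generic ones. *)
Lemma generic_spans_at (I : finType) (E : I -> system -> {mpoly C[d]}) f0 k :
  sparse f0 -> (forall i, poly_family (E i)) ->
  (forall i f, sparse f -> bdeg k (E i f)) ->
  spans_at (E^~ f0) f0 k -> generic (fun f => spans_at (E^~ f) f k).
Proof.
move=> sf0 EP Ek /spans_atP H0.
have {}H0 := H0 sf0 (fun i => Ek i _ sf0).
pose M i (t : low_mnm k) f := (gens (E^~ f) f k i)@_(val (val t)).
have MP i t : polyfun (M i t); last first.
  apply: generic_imp (generic_spanning_rows sf0 MP H0) => f sf H.
  by have [_] := spans_atP sf (fun i => Ek i f sf); apply.
rewrite /M; case: i => [i|[j m]] /=; first exact: EP.
case: [forall beta, _]; last exact: (poly_family_const _ _ 0).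
exact: (poly_familyM (poly_family_id _ _ _ j) (poly_family_const _ _ 'X_[m])).
Qed.

(** The variables of [g] stand for the values y of the equations; this is the substitution
    [y := f]. *)
Definition psub f g : {mpoly C[d]} := mmap (@mpolyC d C) f g.

HB.instance Definition _ f := GRing.RMorphism.copy (psub f) (mmap (@mpolyC d C) f).

Lemma psubC f c : psub f c%:MP = c%:MP.
Proof. exact: mmapC. Qed.

Lemma psubXU f j : psub f 'X_j = f j.
Proof. by rewrite /psub mmapX mmap1U. Qed.

Lemma psubX f m : psub f 'X_[m] = mmap1 f m.
Proof. by rewrite /psub mmapX. Qed.

Lemma psubZ f c g : psub f (c *: g) = c *: psub f g.
Proof. by rewrite -!mul_mpolyC rmorphM /= psubC. Qed.

(* Cramer's rule for the systems [f - y] with [y] a tuple of indeterminates,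
   followed by the substitution [y := f]. *)
Lemma elimination (I : finType) (E : I -> {mpoly C[d]}) f k :
  sparse f -> (forall i, bdeg k (E i)) -> spans_at E f k ->
  exists2 Delta : {mpoly C[d]}, Delta != 0 /\ mdeg_le #|{: low_mnm k}| Delta &
    forall e, bdeg k e -> exists2 Q : I -> {mpoly C[d]},
      forall i, mdeg_le #|{: low_mnm k}| (Q i) &
      psub f Delta * e = \sum_i psub f (Q i) * E i.
Proof.
move=> sf Ek H; have [/(_ H){}H _] := spans_atP sf Ek.
pose ok j m := [forall beta, (blockdeg beta m + chi j beta <= k beta)%N].
(* The coefficient matrix of the generators for [f - y]: the row of [(f j - y_j) * 'X_[m]] is that
   of [f j * 'X_[m]], minus [y_j] in column [m]. At [y = 0] it has full rank. *)
pose M i (t : low_mnm k) : {mpoly C[d]} :=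
  ((gens E f k i)@_(val (val t)))%:MP -
  (if i is inr (j, m) then if ok j m then 'X_j * ((val m == val (val t))%:R)%:MP else 0 else 0).
have [i t|j|Delta [Q [D0 Ddeg Qdeg QM]]] := @cramer_family C d _ _ M.
- apply: bdegB; first exact: bdegC.
  case: i => [i|[j m]]; first exact: bdeg0.
  case: ifP => _; last exact: bdeg0.
  rewrite mulrC mul_mpolyC; apply/bdegZ/bdegX => beta.
  by rewrite blockdegU leq_b1.
- have [u uP] := H j; exists u => j'; rewrite -uP; apply: eq_bigr => i _.
  rewrite mcoeffB mcoeffC eqxx mulr1; case: i => [i|[l m]]; rewrite ?mcoeff0 ?subr0 //.
  case: ifP => _; rewrite ?mcoeff0 ?subr0 // ['X_l * _]mulrC mul_mpolyC mcoeffZ mcoeffX.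
  by rewrite mnm1_eq0 mulr0 subr0.
exists Delta => // e ek.
exists (fun i => \sum_(t : low_mnm k) e@_(val (val t)) *: Q t (inl i)) => [i|].
  by apply: bdeg_sum => t _; exact/bdegZ/Qdeg.
(* After [y := f] the multiples of [f j - y_j] vanish and only the rows of [E] survive. *)
have MX i : \sum_t psub f (M i t) * 'X_[val (val t)] = if i is inl i then E i else 0.
  under eq_bigr do rewrite rmorphB /= psubC mulrBl mul_mpolyC.
  rewrite sumrB -bdeg_low_mnm; last exact: bdeg_gens.
  case: i => [i|[j m]] /=; first by rewrite big1 ?subr0 // => t _; rewrite rmorph0 mul0r.
  rewrite -/(ok j m); case: ifP => mok; last first.
    by rewrite big1 ?subr0 // => t _; rewrite rmorph0 mul0r.
  have [t tm] : exists t : low_mnm k, val (val t) = m.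
    apply: low_mnm_ex => beta; apply: leq_trans (forallP mok beta).
    by rewrite leq_addr.
  rewrite (bigD1 t) //= -tm eqxx mulr1 psubXU big1 ?addr0 ?subrr // => t' tt'.
  case: eqP => [E'|]; last by rewrite mulr0 rmorph0 mul0r.
  by case/eqP: tt'; exact/low_mnm_inj/esym.
have XE t : psub f Delta * 'X_[val (val t)] = \sum_i psub f (Q t (inl i)) * E i.
  transitivity (\sum_i psub f (Q t i) * \sum_t' psub f (M i t') * 'X_[val (val t')]).
    under eq_bigr do rewrite mulr_sumr; rewrite exchange_big /= (bigD1 t) //=.
    rewrite [X in _ + X]big1 ?addr0 => [|t' tt'].
      under eq_bigr do rewrite mulrA -rmorphM.
      by rewrite -mulr_suml -rmorph_sum QM eqxx mulr1.
    under eq_bigr do rewrite mulrA -rmorphM.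
    by rewrite -mulr_suml -rmorph_sum QM eq_sym (negPf tt') mulr0 rmorph0 mul0r.
  rewrite big_sumType /= [X in _ + X]big1 ?addr0 => [|i _]; last by rewrite MX mulr0.
  by apply: eq_bigr => i _; rewrite MX.
rewrite {1}(bdeg_low_mnm ek) mulr_sumr.
under eq_bigr do rewrite -scalerAr XE scaler_sumr.
rewrite exchange_big /=; apply: eq_bigr => i _.
rewrite rmorph_sum mulr_suml; apply: eq_bigr => t _.
by rewrite /= psubZ -scalerAl.
Qed.

(** Sparsity leaves finitely many monomials in [f j], and the shift is linear in their
    coefficients. *)
Lemma poly_family_shift z j : poly_family (fun f => shift z (f j)).
Proof.
pose k := degbound (fun beta => nat_of_bool (chi j beta)).
have : poly_family (fun f => \sum_(m : 'X_{1..d < k})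
    ((f j)@_m)%:MP * shift z 'X_[m]).
  apply: poly_family_sum => m; apply: poly_familyM; last exact: poly_family_const.
  move=> m'; have H := polyfunM (poly_family_id C b chi j m)
    (polyfun_const b chi (m' == 0%MM)%:R).
  by apply: polyfun_ext H => f _; rewrite mcoeffC.
move=> H m; apply: polyfun_ext (H m) => f sf; congr (_@__).
rewrite [in RHS](@mpolywE _ _ k (f j)); last first.
  by apply/bigmax_leqP_seq => m' m'f _; apply/mdeg_degbound/sf; rewrite -mcoeff_msupp.
by rewrite rmorph_sum; apply: eq_bigr => m' _; rewrite mul_mpolyC /= shiftZ.
Qed.

Lemma mpolyw_psub f g s : (forall m, g@_m != 0 -> (mdeg m < s)%N) ->
  psub f g = \sum_(m : 'X_{1..d < s}) g@_m *: mmap1 f m.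
Proof.
move=> gs; rewrite {1}(@mpolywE _ _ s g); last first.
  by apply/bigmax_leqP_seq => m mg _; rewrite gs // -mcoeff_msupp.
by rewrite rmorph_sum; apply: eq_bigr => m _; rewrite /= psubZ psubX.
Qed.

Lemma vanishes_to_mmap1 (p : system) m :
  (forall j, vanishes_to 1 (p j)) -> vanishes_to (mdeg m) (mmap1 p m).
Proof.
move=> p1; rewrite mdegE /mmap1.
elim/big_rec2: _ => [|j y1 y2 _ H]; first exact: vanishes_to0.
by apply: vanishes_toM H; exact: vanishes_toXn.
Qed.

(** The expansion of [g] in powers of [f]: each step expands the cofactors [h] of the remainder once
    more modulo [f]. *)
Lemma lspan_powers f (D : nat) (e : 'I_D -> {mpoly C[d]}) s g :
  (forall g, lspan (fun v => (exists a, v = e a) \/ (exists j h, v = f j * h)) g) ->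
  lspan (fun v => (exists a al, (mdeg al < s)%N /\ v = mmap1 f al * e a) \/
    (exists al h, mdeg al = s /\ v = mmap1 f al * h)) g.
Proof.
move=> e_span; elim: s => [|s IH].
  apply: lspan_mem; right; exists 0%MM, g; rewrite mdeg0; split=> //.
  by rewrite mmap11 mul1r.
apply: lspan_trans IH => _ [[a [al [als ->]]]|[al [h [als ->]]]].
  by apply: lspan_mem; left; exists a, al; rewrite ltnW.
apply: lspan_mull (e_span h) => _ [[a ->]|[j [h' ->]]]; apply: lspan_mem.
  by left; exists a, al; rewrite als.
right; exists (al + U_(j))%MM, h'; rewrite mdegD mdeg1 als addn1; split=> //.
by rewrite -!psubX mpolyXD rmorphM /= psubXU mulrA.
Qed.

(* If the fibre of [f] over 0 is finite then [C[x]] is generated by the [e a]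
   modulo [f], so the products [f ^ alpha * e a] with [|alpha| < s] fill all
   [s]-jets at the [n] zeros; this persists for a generic system, for which
   elimination bounds the dimension of their span by about [r] times the number
   of exponents [alpha]. *)
Lemma fiber_bound f0 f k (r D n : nat) (E : 'I_r -> {mpoly C[d]})
    (e : 'I_D -> {mpoly C[d]}) (z : 'I_n -> 'I_d -> C) :
  sparse f0 -> (forall i, bdeg k (E i)) -> spans_at E f0 k ->
  sparse f -> (forall a, bdeg k (e a)) ->
  (forall g, lspan (fun v => (exists a, v = e a) \/ (exists j h, v = f j * h)) g) ->
  injective z -> (forall i j, (f j).@[z i] = 0) -> (n <= r)%N.
Proof.
move=> sf0 Ek E0 sf ek e_span z_inj zf.
pose delta := #|{: low_mnm k}|.
pose c s := #|{: 'X_{1..d < s}}|.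
rewrite leqNgt; apply/negP => lt_rn.
(* That is, [D * (c s - c t) < c s] for [s = t + delta]: the [D * c t] relations found below leave
   fewer than [c s] of the products with [e] unaccounted for. *)
have [t] : exists t, (D * c (t + delta) < c (t + delta) + D * c t)%N.
  apply: (@slow_growth d); first exact: card_bmultinom_le.
  by case=> // s _; apply/card_gt0P; exists bm0.
apply/negP; rewrite -leqNgt; pose s := (t + delta)%N; rewrite -/s.
(* The products with [E] are joined to those with [e], so that the relations given by elimination
   become vectors on a single index type. *)
pose v (x : 'I_D * 'X_{1..d < s} + 'I_r * 'X_{1..d < s}) f : {mpoly C[d]} :=
  match x with
  | inl (a, al) => mmap1 f al * e a
  | inr (i, al) => mmap1 f al * E i
  end.
pose M x (y : 'I_n * 'X_{1..d < s}) f := (shift (z y.1) (v x f))@_y.2.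
have MP x y : polyfun (M x y).
  have vP g (al : 'X_{1..d}) : poly_family (fun f => shift (z y.1) (mmap1 f al * g)).
    have := poly_familyM (poly_family_prod (index_enum 'I_d) xpredT
      (fun l => poly_familyXn (al l) (poly_family_shift (z y.1) l)))
      (poly_family_const _ _ (shift (z y.1) g)).
    move=> H m; apply: polyfun_ext (H m) => f' _.
    rewrite rmorphM rmorph_prod; congr ((_ * _)@__).
    by apply: eq_bigr => l _; rewrite /= rmorphXn.
  by case: x => -[a al]; exact: vP.
(* At [f] the products with [e] already suffice: the remainders [mmap1 f al * h] with [mdeg al = s]
   vanish to order [s] at every zero. *)
have Mf : spanning_rows (fun x y => M x y f).
  move=> [i beta].
  have [g gP] := jets_surjective i z_inj (bmdeg beta).
  suff [u uP] : exists u, forall y, \sum_x u x * M x y f = (shift (z y.1) g)@_y.2.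
    exists u => -[i' beta']; by rewrite uP gP ?bmdeg.
  elim: (lspan_powers s g e_span) => [|q x y H _ [u uP]].
    by exists (fun=> 0) => y; rewrite rmorph0 mcoeff0 big1 // => x _; rewrite mul0r.
  have [u' u'P] : exists u, forall y, \sum_x u x * M x y f = (shift (z y.1) x)@_y.2.
    case: H => [[a [al [als ->]]]|[al [h [als ->]]]].
      pose x0 : 'I_D * 'X_{1..d < s} + 'I_r * 'X_{1..d < s} := inl (a, BMultinom als).
      exists (fun x => (x == x0)%:R) => y'; rewrite (bigD1 x0) //= eqxx mul1r.
      by rewrite big1 ?addr0 // => x' /negPf ->; rewrite mul0r.
    exists (fun=> 0) => y'; rewrite big1 => [|x' _]; last by rewrite mul0r.
    rewrite rmorphM; apply: esym; apply: vanishes_toMl (bmdeg y'.2) => /=; case: y' => i' _ /=.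
    rewrite -als.
    have -> : shift (z i') (mmap1 f al) = mmap1 (fun j => shift (z i') (f j)) al.
      by rewrite /mmap1 rmorph_prod; apply: eq_bigr => l _; rewrite /= rmorphXn.
    by apply: vanishes_to_mmap1 => j; apply/vanishes_to1; rewrite shift_coeff0.
  exists (fun x => q * u' x + u x) => y'.
  rewrite rmorphD /= shiftZ mcoeffD mcoeffZ -u'P -uP mulr_sumr -big_split /=.
  by apply: eq_bigr => x' _; rewrite mulrDl mulrA.
have [f' sf' [{}Mf E']] := generic_ex (generic_and (generic_spanning_rows sf MP Mf)
  (generic_spans_at sf0 (fun i => poly_family_const _ _ (E i)) (fun i _ _ => Ek i) E0)).
have [Delta [D0 Ddeg] DE] := elimination sf' Ek E'.
have /boolp.choice[Q /all_and2[Qdeg QE]] : forall a, exists Q : 'I_r -> {mpoly C[d]},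
  (forall i, mdeg_le delta (Q i)) /\
  psub f' Delta * e a = \sum_i psub f' (Q i) * E i.
  by move=> a; have [Q Qdeg QE] := DE (e a) (ek a); exists Q.
(* The relation indexed by [(a, ga)] is [Delta * e a - \sum_i Q a i * E i = 0] multiplied by the
   monomial [ga] in [y], with [y := f']; its degree in [y] is less than [t + delta = s]. *)
pose N (w : 'I_D * 'X_{1..d < t}) (x : 'I_D * 'X_{1..d < s} + 'I_r * 'X_{1..d < s}) : C :=
  match x with
  | inl (a, al) => (w.1 == a)%:R * (Delta * 'X_[w.2])@_al
  | inr (i, al) => - (Q w.1 i * 'X_[w.2])@_al
  end.
have := spanning_rows_card Mf (N := N); rewrite card_sum !card_prod !card_ord.
(* The rank [n * c s] plus the number [D * c t] of independent relations is at most the number of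
   products; with [r < n] this contradicts the choice of [t]. *)
move=> H; have {}H : (n * c s + D * c t <= D * c s + r * c s)%N.
  have lt_s (g : {mpoly C[d]}) (ga : 'X_{1..d < t}) m :
      mdeg_le delta g -> (g * 'X_[ga])@_m != 0 -> (mdeg m < s)%N.
    move=> /mdeg_leP gdelta; rewrite -mcoeff_msupp (perm_mem (msuppMX _ _)) => /mapP[m' m'g ->].
    rewrite mdegD /s -addSn leq_add ?bmdeg //; apply: gdelta.
    by rewrite -mcoeff_msupp.
  apply: H => [[a ga] y|w Nw [a ga]].
    transitivity (shift (z y.1) (psub f' (Delta * 'X_[ga]) * e a -
        \sum_i psub f' (Q a i * 'X_[ga]) * E i))@_y.2; last first.
      under eq_bigr do rewrite rmorphM mulrAC.
      rewrite -mulr_suml -QE rmorphM /= mulrAC subrr.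
      by rewrite rmorph0 mcoeff0.
    rewrite (mpolyw_psub _ (fun m => lt_s _ _ m Ddeg)).
    rewrite rmorphB rmorph_sum mcoeffB mulr_suml rmorph_sum !raddf_sum /= big_sumType.
    congr (_ + _).
      transitivity (\sum_a' \sum_al N (a, ga) (inl (a', al)) * M (inl (a', al)) y f').
        by rewrite pair_bigA; apply: eq_bigr => -[].
      rewrite (bigD1 a) //= [X in _ + X]big1 ?addr0 => [|a' a'a]; last first.
        by rewrite big1 // => al _; rewrite eq_sym (negPf a'a) !mul0r.
      apply: eq_bigr => al _; rewrite eqxx mul1r /M /=.
      by rewrite -scalerAl shiftZ mcoeffZ.
    transitivity (\sum_i \sum_al N (a, ga) (inr (i, al)) * M (inr (i, al)) y f').
      by rewrite pair_bigA; apply: eq_bigr => -[].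
    apply: eq_bigr => i _.
    rewrite (mpolyw_psub _ (fun m => lt_s _ _ m (Qdeg a i))).
    rewrite mulr_suml rmorph_sum !raddf_sum; apply: eq_bigr => al _ /=.
    by rewrite -scalerAl shiftZ mcoeffZ mulNr.
  (* For fixed [a], a linear dependency between the relations says [Delta * W = 0]. *)
  pose W := \sum_(ga : 'X_{1..d < t}) w (a, ga) *: 'X_[ga].
  have WE (ga' : 'X_{1..d < t}) : W@_ga' = w (a, ga').
    rewrite raddf_sum (bigD1 ga') //= mcoeffZ mcoeffX eqxx mulr1 big1 ?addr0 //.
    by move=> ga'' /negPf ne; rewrite mcoeffZ mcoeffX -bmeqP ne mulr0.
  suff W0 : W = 0 by rewrite -WE W0 mcoeff0.
  have : Delta * W = 0.
    apply/mpolyP => m; rewrite mcoeff0.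
    have WM : Delta * W = \sum_(ga : 'X_{1..d < t}) w (a, ga) *: (Delta * 'X_[ga]).
      by rewrite mulr_sumr; apply: eq_bigr => ga' _; rewrite scalerAr.
    have [ms|ms] := ltnP (mdeg m) s; last first.
      rewrite WM raddf_sum big1 // => ga' _ /=; rewrite mcoeffZ.
      have [->|/(lt_s _ _ _ Ddeg)] := eqVneq (Delta * 'X_[ga'])@_m 0; first by rewrite mulr0.
      by rewrite ltnNge ms.
    rewrite -[RHS](Nw (inl (a, BMultinom ms))) WM raddf_sum /=.
    transitivity (\sum_a' \sum_ga w (a', ga) * N (a', ga) (inl (a, BMultinom ms))); last first.
      by rewrite pair_bigA; apply: eq_bigr => -[].
    rewrite (bigD1 a) //= [X in _ = _ + X]big1 ?addr0 => [|a' a'a]; last first.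
      by rewrite big1 // => al _; rewrite (negPf a'a) mul0r mulr0.
    by apply: eq_bigr => ga' _; rewrite mcoeffZ eqxx mul1r.
  by move/eqP; rewrite mulf_eq0 (negPf D0) => /eqP.
have : (r.+1 * c s <= n * c s)%N by rewrite leq_mul2r lt_rn orbT.
rewrite mulSn; lia.
Qed.

End FiberBound.

(** * Zeros of ideals over an uncountable field *)

(* A countable union of finite sets is not the whole of K. *)
Definition uncountable_field (K : fieldType) :=
  forall D : K -> nat, exists N, forall s : seq K, exists2 t, t \notin s & (D t <= N)%N.

Section Uncountable.
Variable R : realType.

Lemma avoid_seq (s : seq R) (x y : R) : x < y ->
  exists u v, [/\ x <= u, u < v, v <= y & forall t, u <= t <= v -> t \notin s].
Proof.
elim: s x y => [|a s IH] x y xy; first by exists x, y.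
have [u [v [xu uv vy uvs]]] := IH x y xy.
have [u' [v' [uu' u'v' v'v ha]]] : exists u' v',
    [/\ u <= u', u' < v', v' <= v & forall t, u' <= t <= v' -> t != a].
  have [av|va] := ltP a ((u + v) / 2%:R).
    exists ((u + v) / 2%:R), v; split; [lra|lra|lra|].
    by move=> t /andP[? ?]; rewrite gt_eqF //; lra.
  exists u, (u + (v - u) / 3%:R); split; [lra|lra|lra|].
  by move=> t /andP[? ?]; rewrite lt_eqF //; lra.
exists u', v'; split=> //; [lra|lra|move=> t /andP[ut tv]].
by rewrite inE negb_or ha ?ut //= uvs //; apply/andP; split; lra.
Qed.

(** Cantor's nested intervals: if the claim fails, interval [N + 1] can be made to avoid a finite
    set containing all [t] with [D t <= N], while the supremum of the left endpoints lies in all the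
    intervals. *)
Lemma uncountable_real : uncountable_field R.
Proof.
move=> D; apply: contrapT => H.
have {H}/boolp.choice[A AP] : forall N, exists s : seq R, forall t, (D t <= N)%N -> t \in s.
  move=> N; apply: contrapT => H'; apply: H; exists N => s.
  apply: contrapT => H''; apply: H'; exists s => t tN.
  by apply: contrapT => /negP ts; apply: H''; exists t.
pose P N (I J : R * R) := [/\ I.1 <= J.1, J.1 < J.2, J.2 <= I.2 &
  forall t, J.1 <= t <= J.2 -> t \notin A N].
have /boolp.choice[next nextP] : forall NI : nat * (R * R), exists J,
    NI.2.1 < NI.2.2 -> P NI.1 NI.2 J.
  move=> [N [x y]] /=; have [xy|_] := ltP x y; last by exists (x, y).
  by have [u [v uvP]] := avoid_seq (A N) xy; exists (u, v).
pose I := fix I N := if N is N'.+1 then next (N', I N') else (0, 1) : R * R.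
have I_lt N : (I N).1 < (I N).2.
  by elim: N => [|N IH] /=; [lra|have [] := nextP (N, I N) IH].
have IP N : P N (I N) (I N.+1) by exact: (nextP (N, I N) (I_lt N)).
have I1 N M : (I N).1 <= (I (N + M)%N).1.
  elim: M => [|M IH]; first by rewrite addn0.
  by rewrite addnS; have [? _ _ _] := IP (N + M)%N; apply: le_trans IH _.
have I2 N M : (I (N + M)%N).2 <= (I N).2.
  elim: M => [|M IH]; first by rewrite addn0.
  by rewrite addnS; have [_ _ ? _] := IP (N + M)%N; apply: le_trans IH.
have I12 N M : (I N).1 <= (I M).2.
  have := I1 N M; have := I2 M N; rewrite addnC; have := I_lt (N + M)%N; lra.
pose S := [set (I N).1 | N in [set: nat]]%classic.
have S0 : has_sup S.
  split; first by exists (I 0%N).1, 0%N.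
  by exists (I 0%N).2 => _ [N _ <-]; exact: I12.
have supP N : (I N).1 <= sup S <= (I N).2.
  apply/andP; split; first by apply: ub_le_sup => //; [case: S0|exists N].
  by apply: ge_sup; [case: S0|move=> _ [M _ <-]; exact: I12].
have [_ _ _ /(_ _ (supP _))/negP] := IP (D (sup S)).
by apply; exact: AP.
Qed.

Lemma uncountable_complex : uncountable_field (complex R).
Proof.
move=> D; have [N NP] := uncountable_real (fun x => D (x%:C)%C).
exists N => s; have [t ts Dt] := NP [seq complex.Re z | z <- s].
exists (t%:C)%C => //; apply: contra ts => ts.
by apply/mapP; exists (t%:C)%C.
Qed.

End Uncountable.

Lemma mpoly_ring_ind (C : comNzRingType) (d : nat) (P : {mpoly C[d]} -> Prop) :
  (forall c, P c%:MP) -> (forall l, P 'X_l) ->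
  (forall g h, P g -> P h -> P (g + h)) -> (forall g h, P g -> P h -> P (g * h)) ->
  forall g, P g.
Proof.
move=> PC PX PD PM g; have P1 : P 1 by rewrite -mpolyC1.
have PXm (m : 'X_{1..d}) : P 'X_[m].
  rewrite mpolyXE_id; apply: (big_ind P) => [||l _]; [exact: P1|exact: PM|].
  by elim: (m l) => [|n IHn]; [exact: P1|rewrite exprS; exact: PM].
elim/mpolyind: g => [|c m g _ _ IH]; first by rewrite -mpolyC0.
by apply: PD IH; rewrite -mul_mpolyC; exact: PM.
Qed.

(** * The weak Nullstellensatz and the quotient by a zero-dimensional ideal *)

Section Nullstellensatz.
Variables (C : numClosedFieldType) (d : nat).
Hypothesis C_unc : uncountable_field C.
Implicit Types (g h : {mpoly C[d]}).

Lemma horner_algZ (u : {mpoly C[d]}) c p :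
  horner_alg u (c *: p) = c%:MP * horner_alg u p.
Proof. by rewrite -mul_polyC rmorphM /= horner_algC -mul_mpolyC mulr1. Qed.

Lemma horner_algXsubC (u : {mpoly C[d]}) c :
  horner_alg u ('X - c%:P) = u - c%:MP.
Proof. by rewrite rmorphB /= horner_algX horner_algC -mul_mpolyC mulr1. Qed.

Definition is_ideal (I : {mpoly C[d]} -> Prop) :=
  [/\ I 0, forall g h, I g -> I h -> I (g + h) & forall g h, I g -> I (h * g)].

Lemma ideal_sum I (T : Type) (r : seq T) (P : pred T) (F : T -> {mpoly C[d]}) :
  is_ideal I -> (forall t, P t -> I (F t)) -> I (\sum_(t <- r | P t) F t).
Proof. by move=> [I0 ID _] FI; elim/big_ind: _. Qed.

Lemma idealN I g : is_ideal I -> I g -> I (- g).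
Proof. by move=> [_ _ IM] Ig; rewrite -mulN1r; exact: IM. Qed.

Lemma idealB I g h : is_ideal I -> I g -> I h -> I (g - h).
Proof. by move=> Iid Ig Ih; have [_ ID _] := Iid; apply: ID => //; exact: idealN. Qed.

Lemma distinct_family (D : C -> nat) N (bad : seq C) M :
  (forall s : seq C, exists2 t, t \notin s & (D t <= N)%N) ->
  exists lam : 'I_M -> C, [/\ injective lam, forall i, lam i \notin bad
    & forall i, (D (lam i) <= N)%N].
Proof.
move=> DN.
have [s [us sM sP]] : exists s : seq C, [/\ uniq s, size s = M
    & forall t, t \in s -> t \notin bad /\ (D t <= N)%N].
  elim: M => [|M [s [us sM sP]]]; first by exists [::].
  have [t] := DN (bad ++ s); rewrite mem_cat negb_or => /andP[tb ts] Dt.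
  exists (t :: s); rewrite /= ts us sM; split=> // t'.
  by rewrite inE => /orP[/eqP ->|/sP].
exists (fun i : 'I_M => nth 0 s i); split.
- move=> i j /eqP; rewrite nth_uniq ?sM // => /eqP ij; exact: val_inj.
- by move=> i; have [] := sP (nth 0 s i); rewrite ?mem_nth ?sM.
- by move=> i; have [] := sP (nth 0 s i); rewrite ?mem_nth ?sM.
Qed.

(* If X_l - t has an inverse w_t modulo I for all but finitely many t, then,
   C being uncountable, infinitely many of the w_t have degree less than some
   N; a linear relation between them, multiplied by the product of the
   X_l - t, is a polynomial in X_l lying in I. *)
Lemma ideal_univariate I (l : 'I_d) (bad : seq C) : is_ideal I ->
  (forall t, t \notin bad -> exists w, I (w * ('X_l - t%:MP) - 1)) ->
  exists2 q : {poly C}, q != 0 & I (horner_alg 'X_l q).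
Proof.
move=> Iid unitI; have [I0 ID IM] := Iid.
have /boolp.choice[w wP] : forall t, exists w, t \notin bad -> I (w * ('X_l - t%:MP) - 1).
  move=> t; have [tb|tb] := boolP (t \in bad); first by exists 0.
  by have [w wP] := unitI t tb; exists w.
have [N NP] := C_unc (fun t => msize (w t)).
(* One more point than there are monomials of degree less than [N], so that the [w (lam i)] are
   linearly dependent. *)
have [lam [lam_inj lam_bad lamN]] :=
  @distinct_family _ _ bad #|{: 'X_{1..d < N}}|.+1 NP.
set M := #|_| in lam lam_inj lam_bad lamN.
pose A : 'M[C]_(M.+1, M) := \matrix_(i, j) (w (lam i))@_(enum_val (j : 'I_#|{: 'X_{1..d < N}}|) : 'X_{1..d < N}).
have kerA : kermx A != 0.
  by rewrite kermx_eq0 /row_free neq_ltn ltnS rank_leq_col.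
have [c /sub_kermxP cA c0] := rowV0Pn kerA.
have cw : \sum_i c 0 i *: w (lam i) = 0.
  apply/mpolyP => m; rewrite mcoeff0 raddf_sum /=.
  have [mN|mN] := ltnP (mdeg m) N; last first.
    rewrite big1 // => i _; rewrite mcoeffZ memN_msupp_eq0 ?mulr0 //.
    by apply: msize_mdeg_ge; apply: leq_trans (lamN i) mN.
  have := congr1 (fun X : 'rV_M => X 0 (enum_rank (BMultinom mN))) cA.
  rewrite !mxE => E; rewrite -[RHS]E; apply: eq_bigr => i _.
  by rewrite mcoeffZ mxE enum_rankK.
have [i0 ci0] : exists i0, c 0 i0 != 0.
  apply: contrapT => H; case/eqP: c0; apply/rowP => i; rewrite mxE.
  by apply: contrapT => /eqP ci; apply: H; exists i.
(* The value of [q] at [lam i0] is [c 0 i0] times a product of nonzero differences. *)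
pose q := \sum_i c 0 i *: \prod_(j | j != i) ('X - (lam j)%:P) : {poly C}.
exists q.
  apply: contraNneq ci0 => q0; have := horner0 (lam i0); rewrite -q0 horner_sum.
  rewrite (bigD1 i0) //= [X in _ + X]big1 ?addr0 => [|i ii0]; last first.
    rewrite hornerZ horner_prod (bigD1 i0) 1?eq_sym //= hornerXsubC subrr.
    by rewrite mul0r mulr0.
  rewrite hornerZ horner_prod => /eqP; rewrite mulf_eq0 => /orP[->//|].
  rewrite prodf_seq_eq0 => /hasP[j _ /andP[ji0]]; rewrite hornerXsubC subr_eq0.
  by move=> /eqP/lam_inj ij; rewrite ij eqxx in ji0.
pose F i := \prod_(j | j != i) ('X_l - (lam j)%:MP) : {mpoly C[d]}.
have -> : horner_alg 'X_l q = \sum_i (c 0 i)%:MP * F i.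
  rewrite rmorph_sum; apply: eq_bigr => i _ /=; rewrite horner_algZ rmorph_prod.
  by congr (_ * _); apply: eq_bigr => j _; exact: horner_algXsubC.
(* Each [F i * ('X_l - (lam i)%:MP)] is the full product, which factors out of the vanishing
   combination of the [w (lam i)]. *)
have F0 : \sum_i (c 0 i)%:MP * F i * (w (lam i) * ('X_l - (lam i)%:MP)) = 0.
  transitivity ((\prod_j ('X_l - (lam j)%:MP)) * \sum_i c 0 i *: w (lam i)).
    rewrite mulr_sumr; apply: eq_bigr => i _; rewrite -mul_mpolyC (bigD1 i) //= -/(F i).
    by ring.
  by rewrite cw mulr0.
have -> : \sum_i (c 0 i)%:MP * F i =
    - \sum_i (c 0 i)%:MP * F i * (w (lam i) * ('X_l - (lam i)%:MP) - 1).
  under [in RHS]eq_bigr do rewrite mulrBr mulr1.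
  by rewrite sumrB F0 sub0r opprK.
apply: idealN => //; apply: ideal_sum => // i _; apply: (IM).
exact/wP/lam_bad.
Qed.

Definition adjoin (I : {mpoly C[d]} -> Prop) p g := exists a h, I a /\ g = a + h * p.

Lemma is_ideal_adjoin I p : is_ideal I -> is_ideal (adjoin I p).
Proof.
move=> [I0 ID IM]; split=> [|g g' [a [h [Ia ->]]] [a' [h' [Ia' ->]]]|g k [a [h [Ia ->]]]].
- by exists 0, 0; split=> //; rewrite mul0r addr0.
- by exists (a + a'), (h + h'); split; [exact: ID|ring].
- by exists (k * a), (k * h); split; [exact: IM|ring].
Qed.

(** Otherwise all the ['X_l - t%:MP] are invertible modulo [I]. A nonzero polynomial in ['X_l] lying
    in [I] splits into such factors, and cancelling them one by one puts 1 in [I]. *)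
Lemma adjoin_proper I l : is_ideal I -> ~ I 1 ->
  exists t, ~ adjoin I ('X_l - t%:MP) 1.
Proof.
move=> Iid I1; apply: contrapT => H.
have [I0 ID IM] := Iid.
have unitI t : exists w, I (w * ('X_l - t%:MP) - 1).
  have [a [h [Ia E]]] : adjoin I ('X_l - t%:MP) 1.
    by apply: contrapT => H'; apply: H; exists t.
  exists h; rewrite [X in _ - X]E opprD addrCA subrr addr0; exact: idealN.
have [q q0 Iq] := @ideal_univariate I l [::] Iid (fun t _ => unitI t).
have [r qE] := closed_field_poly_normal q.
apply: I1; move: Iq; rewrite qE -mul_polyC rmorphM /= => Iq.
have {Iq} : I (horner_alg 'X_l (\prod_(z <- r) ('X - z%:P))).
  have := IM _ ((lead_coef q)^-1)%:MP Iq.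
  rewrite horner_algC -mul_mpolyC mulr1 mulrA -mpolyCM mulVf ?lead_coef_eq0 //.
  by rewrite mpolyC1 mul1r.
rewrite rmorph_prod /=; elim: r {qE} => [|z r IH]; first by rewrite big_nil.
rewrite big_cons horner_algXsubC => Iq.
apply: IH; have [w wP] := unitI z.
have := idealB Iid (IM _ w Iq) (IM _ (\prod_(j <- r) horner_alg 'X_l ('X - j%:P)) wP).
by congr I; ring.
Qed.

Lemma ideal_eval I z g : is_ideal I -> (forall l, I ('X_l - (z l)%:MP)) ->
  I (g - (g.@[z])%:MP).
Proof.
move=> Iid IX; have [I0 ID IM] := Iid.
elim/mpoly_ring_ind: g => [c|l|g h IHg IHh|g h IHg IHh].
- by rewrite mevalC subrr.
- by rewrite mevalXU.
- by have := ID _ _ IHg IHh; rewrite mevalD mpolyCD; congr I; ring.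
- have := ID _ _ (IM _ h IHg) (IM _ (g.@[z])%:MP IHh).
  by rewrite mevalM mpolyCM; congr I; ring.
Qed.

(** Adjoining ['X_l - (z l)%:MP] for each variable in turn keeps the ideal proper. Modulo the
    resulting ideal [J] each polynomial equals its value at [z], so a nonzero value on [I] would put
    1 in [J]. *)
Lemma weak_nullstellensatz I : is_ideal I -> ~ I 1 ->
  exists z, forall g, I g -> g.@[z] = 0.
Proof.
move=> Iid I1.
have [J [z [Jid J1 IJ Jz]]] : exists J z, [/\ is_ideal J, ~ J 1, forall g, I g -> J g &
    forall l, l \in enum 'I_d -> J ('X_l - (z l)%:MP)].
  elim: (enum 'I_d) => [|l r [J [z [Jid J1 IJ Jz]]]]; first by exists I, (fun=> 0).
  have [z' [zJ zJ']] : exists z' : 'I_d -> C, ~ adjoin J ('X_l - (z' l)%:MP) 1 /\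
      forall l', l' \in r -> J ('X_l' - (z' l')%:MP).
    have [lr|lr] := boolP (l \in r).
      exists z; split=> // -[a [h [Ja E]]]; apply: J1; rewrite E.
      by have [_ JD JM] := Jid; apply: JD => //; apply: JM; exact: Jz.
    have [t tJ] := @adjoin_proper J l Jid J1.
    exists (fun l' => if l' == l then t else z l'); rewrite eqxx; split=> // l' l'r.
    by case: eqP => [E|_]; [rewrite -E l'r in lr|exact: Jz].
  exists (adjoin J ('X_l - (z' l)%:MP)), z'; split=> //.
  - exact: is_ideal_adjoin.
  - by move=> g /IJ Jg; exists g, 0; rewrite mul0r addr0.
  - have [J0 _ _] := Jid.
    move=> l'; rewrite inE => /orP[/eqP ->|/zJ' Jl']; first by exists 0, 1; rewrite add0r mul1r.
    by exists ('X_l' - (z' l')%:MP), 0; rewrite mul0r addr0.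
exists z => g Ig; apply: contrapT => /eqP gz; apply: J1.
have [_ _ JM] := Jid.
have := idealB Jid (IJ _ Ig) (ideal_eval g Jid (fun l => Jz l (mem_enum _ l))).
rewrite subKr => /(JM _ (((g.@[z])^-1)%:MP)).
by rewrite -mpolyCM mulVf // mpolyC1.
Qed.

Definition generated_ideal (f : 'I_d -> {mpoly C[d]}) :=
  lspan (fun v => exists j h, v = f j * h).

Lemma is_ideal_generated f : is_ideal (generated_ideal f).
Proof.
split; [exact: lspan0|exact: lspanD|move=> g h].
apply: lspan_mull => _ [j [h' ->]]; apply: lspan_mem.
by exists j, (h * h'); rewrite mulrCA.
Qed.

(** If [t] is not the [l]-th coordinate of a solution, then ['X_l - t%:MP] is invertible modulo [I]
    by the Nullstellensatz. Hence [I] contains a nonzero polynomial in each single variable, which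
    serves to lower large exponents. *)
Lemma finite_solutions_quotient f : zero_dimensional f ->
  exists D (e : 'I_D -> {mpoly C[d]}), forall g,
    lspan (fun v => (exists a, v = e a) \/ (exists j h, v = f j * h)) g.
Proof.
move=> fin_f; have Iid := is_ideal_generated f; set I := generated_ideal f in Iid.
have [I0 ID IM] := Iid.
have /boolp.choice[q qP] : forall l, exists q : {poly C}, q != 0 /\ I (horner_alg 'X_l q).
  move=> l; have [s sE] := (finite_seqP _).1 fin_f.
  have [t tb|q q0 Iq] := @ideal_univariate I l [seq z l | z <- s] Iid; last by exists q.
  have [a [h [Ia E]]] : adjoin I ('X_l - t%:MP) 1.
    apply: contrapT => /(weak_nullstellensatz (is_ideal_adjoin _ Iid))[z zP].
    case/negP: tb; apply/mapP; exists z.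
      suff : solutions f z by rewrite sE.
      move=> j; apply: zP; exists (f j), 0; rewrite mul0r addr0; split=> //.
      by apply: lspan_mem; exists j, 1; rewrite mulr1.
    have := zP ('X_l - t%:MP); rewrite mevalB mevalXU mevalC => H.
    apply/eqP; rewrite eq_sym -subr_eq0 H //.
    by exists 0, 1; rewrite add0r mul1r.
  exists h; rewrite [X in _ - X]E opprD addrCA subrr addr0; exact: idealN.
(* A monomial of degree greater than [d * M] has some exponent [m l] greater than [M], hence above
   the degree of [q l]. *)
pose M := (\max_l size (q l))%N; pose S := {: 'X_{1..d < (d * M).+1}}.
exists #|S|, (fun a => 'X_[val (enum_val a : 'X_{1..d < (d * M).+1})]) => g.
rewrite [g]mpolyE; apply: lspan_sum => m _; apply: lspanZ.
have [n] := ubnP (mdeg m); elim: n m => // n IH m; rewrite ltnS => mn.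
have [mS|mS] := ltnP (mdeg m) (d * M).+1.
  apply: lspan_mem; left; exists (enum_rank (BMultinom mS)).
  by rewrite enum_rankK.
have [l lM] : exists l, (M < m l)%N.
  apply: contrapT => H; move: mS; rewrite leqNgt ltnS => /negP; apply.
  rewrite mdegE; have -> : (d * M = \sum_(l < d) M)%N by rewrite sum_nat_const card_ord.
  by apply: leq_sum => l _; rewrite leqNgt; apply/negP => lM; apply: H; exists l.
have [ql0 Iql] := qP l.
have qM : (size (q l) <= M)%N by rewrite /M (bigD1 l) //= leq_maxl.
pose s := (size (q l)).-1.
have sE : size (q l) = s.+1 by rewrite prednK // lt0n size_poly_eq0.
have sm : (s <= m l)%N by lia.
(* ['X_[m]] is ['X_[m']] times ['X_l ^+ s], with [s] the degree of [q l], and modulo [I] that power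
   is a combination of lower ones. *)
pose m' := [multinom (m i - (l == i) * s)%N | i < d].
have mE i : 'X_[m'] * 'X_l ^+ i = 'X_[m' + U_(l) *+ i] :> {mpoly C[d]}.
  by rewrite mpolyXn mpolyXD.
have mEs : (m' + U_(l) *+ s)%MM = m.
  apply/mnmP => i; rewrite mnmDE mulmnE mnm1E mnmE.
  by case: eqP => [<-|_]; lia.
have degm' : (mdeg m' + s)%N = mdeg m.
  by rewrite -[in RHS]mEs mdegD mdegMn mdeg1 mul1n.
have lin : horner_alg 'X_l (q l) = \sum_(i < s.+1) (q l)`_i *: 'X_l ^+ i.
  rewrite -sE -{1}[q l]coefK poly_def rmorph_sum; apply: eq_bigr => i _.
  by rewrite /= horner_algZ mul_mpolyC rmorphXn /= horner_algX.
have lc0 : (q l)`_s != 0 by rewrite -lead_coefE lead_coef_eq0.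
have -> : 'X_[m] = ((q l)`_s)^-1 *: ('X_[m'] * horner_alg 'X_l (q l)) -
    \sum_(i < s) (((q l)`_s)^-1 * (q l)`_i) *: 'X_[m' + U_(l) *+ i] :> {mpoly C[d]}.
  rewrite lin big_ord_recr /= mulrDr scalerDr -scalerAr scalerA mulVf // scale1r.
  rewrite mE mEs mulr_sumr scaler_sumr addrAC -sumrB big1 ?add0r // => i _.
  by rewrite -scalerAr scalerA mE subrr.
apply: lspanB.
  apply: lspanZ; apply: lspan_sub (IM _ 'X_[m'] Iql) => v ?; by right.
apply: lspan_sum => i _; apply: lspanZ; apply: IH.
by rewrite mdegD mdegMn mdeg1 mul1n; apply: leq_trans mn; rewrite -degm' ltn_add2l.
Qed.

End Nullstellensatz.

(** * The product system *)

(** [w] is column [t] of the inverse Vandermonde matrix. *)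
Lemma vandermonde_dual (K : fieldType) n (c : 'I_n -> K) (t : 'I_n) :
  injective c -> exists w : 'I_n -> K, forall s : 'I_n, \sum_i w i * c i ^+ s = (s == t)%:R.
Proof.
move=> c_inj; pose V := Vandermonde n (\row_i c i).
have Vu : V \in unitmx.
  rewrite unitmxE unitfE det_Vandermonde; apply/prodf_neq0 => i _.
  apply/prodf_neq0 => j ij; rewrite !mxE subr_eq0.
  by apply: contraTneq ij => /c_inj ->; rewrite ltnn.
exists (fun i => (invmx V *m delta_mx t (ord0 : 'I_1)) i 0) => s.
have := congr1 (fun A : 'cV_n => A s 0) (mulKVmx Vu (delta_mx t 0)).
rewrite [RHS]mxE eqxx andbT => <-; rewrite mxE; apply: eq_bigr => i _.
by rewrite mulrC; congr (_ * _); rewrite !mxE.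
Qed.

Section ProductSystem.
Variables (C : numClosedFieldType) (d : nat) (B : finType) (b : 'I_d -> B).
Variable chi : 'I_d -> pred B.
Implicit Types (g h : {mpoly C[d]}) (m : 'X_{1..d}).
Implicit Types (k : B -> nat) (beta : B) (phi : 'I_d -> B) (psi : {ffun 'I_d -> B}).
Local Notation bdeg := (bdeg b).
Local Notation blockdeg := (blockdeg b).

Definition block beta : pred 'I_d := [pred l | b l == beta].

(** Positions start at 1: in a moment form the exponent 0 belongs to the constant term. *)
Definition pos (l : 'I_d) : nat := (index l (enum (block (b l)))).+1.

Lemma pos_le l : (pos l <= #|block (b l)|)%N.
Proof. by rewrite /pos cardE index_mem mem_enum inE. Qed.

Lemma pos_inj l l' : b l = b l' -> pos l = pos l' -> l = l'.
Proof.
rewrite /pos => <- [E].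
have ll : l \in enum (block (b l)) by rewrite mem_enum inE.
by rewrite -[l](nth_index l ll) E nth_index // -index_mem -E index_mem.
Qed.

Definition moment_form (c : C) beta : {mpoly C[d]} :=
  1 + \sum_(l | b l == beta) c ^+ pos l *: 'X_l.

Lemma moment_form0 beta : moment_form 0 beta = 1.
Proof. by rewrite /moment_form big1 ?addr0 // => l _; rewrite expr0n scale0r. Qed.

Lemma bdeg_moment_form c beta :
  bdeg (fun beta' => (beta' == beta) : nat) (moment_form c beta).
Proof.
apply: bdegD; first exact: bdeg1.
apply: bdeg_sum => l /eqP bl; apply/bdegZ/bdegX => beta'.
by rewrite blockdegU bl eq_sym.
Qed.

(** A block with r variables has an (r + 1)-dimensional space of affine forms, in which r + 1 points
    of the moment curve are independent by Vandermonde. *)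
Lemma moment_form_span beta (cs : seq C) :
  uniq cs -> size cs = #|block beta|.+1 ->
  lspan (fun v => exists2 c, c \in cs & v = moment_form c beta) 1 /\
  (forall l, b l = beta ->
    lspan (fun v => exists2 c, c \in cs & v = moment_form c beta) 'X_l).
Proof.
move=> ucs scs; set n := #|_|.+1 in scs.
pose c (i : 'I_n) := nth 0 cs i.
have c_inj : injective c.
  by move=> i j /eqP; rewrite nth_uniq ?scs // => /eqP ij; apply: val_inj.
have c_cs i : c i \in cs by rewrite mem_nth ?scs.
(* The dual vector of index [t] isolates the constant term for [t = 0] and otherwise the variable at
   position [t]. *)
have key (t : 'I_n) : exists w, \sum_i w i *: moment_form (c i) beta =
    (0%N == t)%:R *: 1 + \sum_(l | b l == beta) (pos l == t)%:R *: 'X_l.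
  have [w wP] := vandermonde_dual t c_inj; exists w.
  under eq_bigr do rewrite scalerDr scaler_sumr.
  rewrite big_split /= exchange_big /=; congr (_ + _).
    rewrite -scaler_suml; congr (_ *: _); have := wP ord0.
    by rewrite -val_eqE /= => <-; apply: eq_bigr => i _; rewrite mulr1.
  apply: eq_bigr => l /eqP bl.
  under eq_bigr do rewrite scalerA; rewrite -scaler_suml; congr (_ *: _).
  have ln : (pos l < n)%N by rewrite ltnS -bl pos_le.
  by have := wP (Ordinal ln); rewrite -val_eqE.
have span_w (w : 'I_n -> C) : lspan (fun v => exists2 c, c \in cs & v = moment_form c beta)
    (\sum_i w i *: moment_form (c i) beta).
  by apply: lspan_sum => i _; apply/lspanZ/lspan_mem; exists (c i).
split=> [|l bl].
  have [w wP] := key ord0; have := span_w w; rewrite wP eqxx scale1r.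
  by rewrite big1 ?addr0 // => l _; rewrite scale0r.
have ln : (pos l < n)%N by rewrite ltnS -bl pos_le.
have [w wP] := key (Ordinal ln); have := span_w w; rewrite wP /= scale0r add0r.
rewrite (bigD1 l) ?bl //= eqxx scale1r big1 ?addr0 // => l' /andP[/eqP bl' l'l].
case: eqP => [/pos_inj E|_]; last by rewrite scale0r.
by case/eqP: l'l; apply: E; rewrite bl.
Qed.

(* The nodes are negative, so that the coefficients of [zero_poly] are positive
   and the zeros of [product_system] lie in the torus. *)
Definition node (j : 'I_d) : C := - j.+1%:R.

Lemma node_inj : injective node.
Proof. by move=> i j /oppr_inj/eqP; rewrite eqr_nat => /eqP[] /val_inj. Qed.

Lemma node_neq0 j : node j != 0.
Proof. by rewrite oppr_eq0 pnatr_eq0. Qed.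

Definition factor j beta := moment_form (node j) beta.

Definition blocks j := [seq beta <- enum B | chi j beta].

Lemma mem_blocks j beta : (beta \in blocks j) = chi j beta.
Proof. by rewrite mem_filter mem_enum andbT. Qed.

Lemma blocks_uniq j : uniq (blocks j).
Proof. exact/filter_uniq/enum_uniq. Qed.

Definition product_system (j : 'I_d) : {mpoly C[d]} := \prod_(beta <- blocks j) factor j beta.

Definition balanced phi := [forall beta, #|[pred j | phi j == beta]| == #|block beta|].

(* A zero of [product_system] is obtained by choosing in each equation j the
   block [psi j] of the factor that vanishes; exactly [#|block beta|] of the
   chosen factors must belong to each block beta. *)
Definition assignment psi := [forall j, chi j (psi j)] && balanced psi.

Definition prefix_product (s : seq B) j beta : {mpoly C[d]} :=
  \prod_(beta' <- take (index beta s) s) factor j beta'.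

(** What peeling leaves of the equations from [t] on: in equation [j], the factors listed before the
    chosen one [psi j]. For [t = 0], with [psi] ranging over the assignments, these products span
    the quotient. *)
Definition residue (t : nat) psi : {mpoly C[d]} :=
  \prod_(j : 'I_d | (t <= j)%N) prefix_product (blocks j) j (psi j).

Lemma bdeg_prod_factor j (s : seq B) : uniq s ->
  bdeg (fun beta => (beta \in s) : nat) (\prod_(beta <- s) factor j beta).
Proof.
elim: s => [|beta s IH] /=; first by rewrite big_nil => _; exact: bdeg1.
case/andP=> bs us; rewrite big_cons.
have := bdegM (@bdeg_moment_form (node j) beta) (IH us).
apply: bdegW => beta'; rewrite inE; case: eqP => [->|_] //=.
by rewrite (negPf bs).
Qed.

Lemma sparse_product_system : sparse b chi product_system.
Proof.
move=> j; have := @bdeg_prod_factor j _ (blocks_uniq j).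
by apply: bdegW => beta; rewrite mem_blocks.
Qed.

(** Interpolates between the system of single affine forms chosen by [phi], for [t = d], and the
    product system, for [t = 0]. *)
Definition partial_gen (t : nat) phi k (v : {mpoly C[d]}) :=
  (exists (j : 'I_d) h k', [/\ (j < t)%N, bdeg k' h,
     forall beta, (k' beta + (beta == phi j) <= k beta)%N & v = factor j (phi j) * h]) \/
  (exists (j : 'I_d) h k', [/\ (t <= j)%N, bdeg k' h,
     forall beta, (k' beta + chi j beta <= k beta)%N & v = product_system j * h]).

Definition residue_gen (t : nat) phi (v : {mpoly C[d]}) :=
  exists psi, [/\ assignment psi, forall j : 'I_d, (j < t)%N -> psi j = phi j
                & v = residue t psi].

Lemma sum_card_fibers (F : 'I_d -> B) : (\sum_beta #|[pred j | F j == beta]|)%N = d.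
Proof.
rewrite -[RHS]card_ord -sum1_card (partition_big F xpredT) //=.
by apply: eq_bigr => beta _; rewrite sum1_card.
Qed.

(** Both families of cardinalities add up to [d], so they cannot differ by deficits alone. *)
Lemma unbalanced_block phi : ~~ balanced phi ->
  exists beta, (#|block beta| < #|[pred j | phi j == beta]|)%N.
Proof.
move=> /forallPn[beta0 ne0]; apply: contrapT => H.
have le beta : (#|[pred j | phi j == beta]| <= #|block beta|)%N.
  by rewrite leqNgt; apply/negP => lt; apply: H; exists beta.
have := sum_card_fibers phi; rewrite -[in RHS](sum_card_fibers b).
rewrite (bigD1 beta0) //= [in RHS](bigD1 beta0) //=.
have : (\sum_(i | i != beta0) #|[pred j | phi j == i]| <=
        \sum_(i | i != beta0) #|[pred j | b j == i]|)%N by apply: leq_sum.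
have : (#|[pred j | phi j == beta0]| < #|[pred j | b j == beta0]|)%N.
  by rewrite ltn_neqAle ne0 le.
lia.
Qed.

Definition node_seq phi beta := [seq node j | j <- enum [pred j | phi j == beta]].

(** For [t = d] all equations are affine forms. If [phi] is balanced, the forms of each block
    together with 1 span all affine forms of the block, so everything reduces to constants;
    otherwise some block has too many forms, and 1 is a combination of them. *)
Lemma partial_span_base phi k : (forall j, chi j (phi j)) -> (forall beta, 0 < k beta)%N ->
  forall g, bdeg k g -> lspan (fun v => residue_gen d phi v \/ partial_gen d phi k v) g.
Proof.
move=> chi_phi k0 g gk; apply: lspan_trans (bdeg_lspan gk) => _ [m mk ->] {g gk}.
have factor_gen c beta (m' : 'X_{1..d}) : c \in node_seq phi beta ->
    (forall beta', blockdeg beta' m' + (beta' == beta) <= k beta')%N ->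
    lspan (fun v => residue_gen d phi v \/ partial_gen d phi k v)
      ('X_[m'] * moment_form c beta).
  move=> /mapP[j]; rewrite mem_enum inE => /eqP phij -> m'k.
  apply: lspan_mem; right; left; exists j, 'X_[m'], (fun beta' => blockdeg beta' m').
  split=> //; [exact: bdegX|by rewrite phij|by rewrite mulrC -phij].
have [bal|unbal] := boolP (balanced phi); last first.
  have [beta lt_beta] := unbalanced_block unbal.
  pose cs := take #|block beta|.+1 (node_seq phi beta).
  have ucs : uniq cs by rewrite take_uniq // map_inj_uniq ?enum_uniq //; exact: node_inj.
  have scs : size cs = #|block beta|.+1.
    by rewrite size_takel // size_map -cardE.
  have [span1 spanX] := moment_form_span ucs scs.
  (* Without variables of [beta] in [m], the constant 1 is expanded, for which [0 < k beta] leaves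
     room; otherwise one variable of [beta] is traded for the forms, at no cost in degree. *)
  have [m0|m0] := posnP (blockdeg beta m).
    rewrite -['X_[m]]mulr1; apply: lspan_mull span1 => _ [c /mem_take ccs ->].
    apply: factor_gen => // beta'; case: eqP => [->|_]; last by rewrite addn0.
    by rewrite m0 add0n k0.
  have [l bl ml] : exists2 l, b l = beta & m l != 0%N.
    apply: contrapT => H; move: m0; rewrite /blockdeg big1 // => l /eqP bl.
    by apply: contrapT => /eqP ml; apply: H; exists l.
  have mE : m = (m - U_(l) + U_(l))%MM by rewrite submK // lep1mP.
  rewrite mE mpolyXD; apply: lspan_mull (spanX _ bl) => _ [c /mem_take ccs ->].
  apply: factor_gen => // beta'; have := mk beta'.
  by rewrite {1}mE blockdegD blockdegU bl eq_sym.
have phi_assignment : assignment [ffun j => phi j].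
  apply/andP; split; first by apply/forallP => j; rewrite ffunE.
  apply/forallP => beta; have := forallP bal beta; congr (_ == _).
  by apply: eq_card => j; rewrite !inE ffunE.
have [n] := ubnP (mdeg m); elim: n m mk => // n IH m mk; rewrite ltnS => mn.
have [->|m0] := eqVneq m 0%MM.
  apply: lspan_mem; left; exists [ffun j => phi j]; split=> // [j _|]; first by rewrite ffunE.
  by rewrite mpolyX0 /residue big1 // => j; rewrite leqNgt ltn_ord.
have [l ml] : exists l, m l != 0%N.
  apply: contrapT => H; case/eqP: m0; apply/mnmP => l; rewrite mnm0E.
  by apply: contrapT => /eqP ml; apply: H; exists l.
have mE : m = (m - U_(l) + U_(l))%MM by rewrite submK // lep1mP.
(* Node 0 contributes the constant form 1. *)
pose cs := 0 :: node_seq phi (b l).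
have ucs : uniq cs.
  rewrite /= map_inj_uniq ?enum_uniq ?andbT; last exact: node_inj.
  by apply/mapP => -[j _ /esym/eqP]; rewrite (negPf (node_neq0 j)).
have scs : size cs = #|block (b l)|.+1.
  by rewrite /= size_map -cardE (eqP (forallP bal (b l))).
have [_ /(_ l erefl) spanX] := moment_form_span ucs scs.
have m'k beta' : (blockdeg beta' (m - U_(l))%MM + (beta' == b l) <= k beta')%N.
  by have := mk beta'; rewrite {1}mE blockdegD blockdegU eq_sym.
rewrite mE mpolyXD; apply: lspan_mull spanX => _ [c + ->].
rewrite inE => /orP[/eqP ->|ccs]; last exact: factor_gen.
rewrite moment_form0 mulr1; apply: IH.
  by move=> beta'; apply: leq_trans (m'k beta'); rewrite leq_addr.
by apply: leq_trans mn; rewrite [in X in (_ < X)%N]mE mdegD mdeg1 addn1.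
Qed.

Lemma residueS (jt : 'I_d) psi :
  residue jt psi = prefix_product (blocks jt) jt (psi jt) * residue jt.+1 psi.
Proof.
rewrite /residue (bigD1 jt) //=; congr (_ * _); apply: eq_bigl => j.
by rewrite ltn_neqAle andbC eq_sym.
Qed.

(* Peels the factors of the equation jt off one at a time: modulo the factor of
   [beta], the level [jt.+1] statement with [phi jt := beta] applies. *)
Lemma partial_span_step (jt : 'I_d) phi (s : seq B) k :
  (forall phi' k', (forall j : 'I_d, (j < jt)%N -> phi' j = phi j) -> chi jt (phi' jt) ->
    (forall beta, d - jt.+1 < k' beta)%N -> forall g, bdeg k' g ->
    lspan (fun v => residue_gen jt.+1 phi' v \/ partial_gen jt.+1 phi' k' v) g) ->
  uniq s -> (forall beta, beta \in s -> chi jt beta) ->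
  (forall beta, d - jt.+1 + (beta \in s) < k beta)%N ->
  forall g, bdeg k g ->
  lspan (fun v =>
    (exists psi, [/\ assignment psi, forall j : 'I_d, (j < jt)%N -> psi j = phi j,
       psi jt \in s & v = prefix_product s jt (psi jt) * residue jt.+1 psi]) \/
    partial_gen jt phi k v \/
    (exists h k', [/\ bdeg k' h, forall beta, (k' beta + (beta \in s) <= k beta)%N
       & v = (\prod_(beta <- s) factor jt beta) * h])) g.
Proof.
move=> IHt; elim: s k => [|beta s IHs] k us chi_s ks g gk.
  apply: lspan_mem; right; right; exists g, k; split=> // [beta|].
    by rewrite addn0.
  by rewrite big_nil mul1r.
move: us => /= /andP[bs us].
pose phi' j := if j == jt then beta else phi j.
have phi'lt (j : 'I_d) : (j < jt)%N -> phi' j = phi j.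
  by rewrite /phi'; case: eqP => // ->; rewrite ltnn.
have chi_beta : chi jt beta by rewrite chi_s ?mem_head.
have phi'jt : phi' jt = beta by rewrite /phi' eqxx.
have kn beta' : (d - jt.+1 < k beta')%N.
  by apply: leq_ltn_trans (ks beta'); exact: leq_addr.
have chi_jt : chi jt (phi' jt) by rewrite phi'jt.
apply: lspan_trans (IHt phi' k phi'lt chi_jt kn g gk) => {g gk} v.
case=> [[psi [apsi psi_phi' ->]]|[[j [h [k' [jlt hk' kk' ->]]]]|[j [h [k' [jge hk' kk' ->]]]]]].
- apply: lspan_mem; left; exists psi; have psi_jt : psi jt = beta by rewrite psi_phi' //.
  split=> // [j jlt||]; first by rewrite psi_phi' ?phi'lt // ltnW.
    by rewrite psi_jt mem_head.
  by rewrite psi_jt /prefix_product /= eqxx take0 big_nil mul1r.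
- have [jE|j_jt] := eqVneq j jt; last first.
    have {}jlt : (j < jt)%N by move: jlt; rewrite ltnS leq_eqVlt val_eqE (negPf j_jt).
    apply: lspan_mem; right; left; left; exists j, h, k'; rewrite -phi'lt //.
  rewrite {j jlt}jE phi'jt in kk' *.
  (* The degree still available after a factor of block [beta] has been extracted. *)
  pose k2 beta' := (k beta' - (beta' == beta))%N.
  have hk2 : bdeg k2 h by apply: bdegW hk' => beta'; rewrite /k2; have := kk' beta'; lia.
  have ksE beta' : (k2 beta' + (beta' == beta) = k beta')%N.
    by rewrite /k2 subnK //; have := kk' beta'; lia.
  have ks2 beta' : (d - jt.+1 + (beta' \in s) < k2 beta')%N.
    have := ks beta'; rewrite inE -ksE; case: (eqVneq beta' beta) => [->|_] /=.
      by rewrite (negPf bs); lia.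
    by rewrite addn0.
  have chi_s' beta' : beta' \in s -> chi jt beta'.
    by move=> bs'; apply: chi_s; rewrite inE bs' orbT.
  have fdeg k1 h1 : bdeg k1 h1 ->
      bdeg (fun beta' => (beta' == beta) + k1 beta')%N (factor jt beta * h1).
    by move=> h1k; exact: (bdegM (@bdeg_moment_form (node jt) beta) h1k).
  apply: lspan_mull (IHs k2 us chi_s' ks2 h hk2) => w.
  case=> [[psi [apsi psi_phi psis ->]]|[[[j [h1 [k1 [jlt h1k k1k ->]]]]|
      [j [h1 [k1 [jge h1k k1k ->]]]]]|[h1 [k1 [h1k k1k ->]]]]]; apply: lspan_mem.
  + left; exists psi; split=> //; first by rewrite inE psis orbT.
    rewrite mulrA; congr (_ * _); rewrite /prefix_product /=.
    case: eqP => [E|_]; last by rewrite big_cons.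
    by rewrite E psis in bs.
  + right; left; left; exists j, (factor jt beta * h1), (fun beta' => (beta' == beta) + k1 beta')%N.
    split=> //; [exact: fdeg|move=> beta'|by rewrite mulrCA].
    by have := k1k beta'; rewrite -ksE; lia.
  + right; left; right; exists j, (factor jt beta * h1), (fun beta' => (beta' == beta) + k1 beta')%N.
    split=> //; [exact: fdeg|move=> beta'|by rewrite mulrCA].
    by have := k1k beta'; rewrite -ksE; lia.
  + right; right; exists h1, k1; split=> // [beta'|]; last by rewrite big_cons mulrA.
    have := k1k beta'; rewrite inE -ksE; case: (eqVneq beta' beta) => [->|_] /=; last by lia.
    by rewrite (negPf bs); lia.
- by apply: lspan_mem; right; left; right; exists j, h, k'; split=> //; rewrite ltnW.
Qed.

(** Downward induction on [t] from [partial_span_base]; peeling one equation consumes at most one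
    degree in each block, whence the bound [d - t]. *)
Lemma partial_span (t : nat) phi k : (t <= d)%N ->
  (forall j : 'I_d, (j < t)%N -> chi j (phi j)) -> (forall beta, d - t < k beta)%N ->
  forall g, bdeg k g -> lspan (fun v => residue_gen t phi v \/ partial_gen t phi k v) g.
Proof.
move=> td; have -> : t = (d - (d - t))%N by rewrite subKn.
have : (d - t <= d)%N by exact: leq_subr.
move: (d - t)%N => n nd {t td}; rewrite subKn //.
elim: n nd phi k => [|n IH] nd phi k chi_phi kn.
  rewrite subn0; apply: partial_span_base => // j.
  by apply: chi_phi; rewrite subn0.
move=> g gk; have lt_d : (d - n.+1 < d)%N by lia.
pose jt := Ordinal lt_d.
have jtE : (jt.+1 = d - n)%N by rewrite /= -subSn // subSS.
have dn : (d - jt.+1 = n)%N by rewrite jtE subKn // ltnW.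
have step phi' k' : (forall j : 'I_d, (j < jt)%N -> phi' j = phi j) -> chi jt (phi' jt) ->
    (forall beta, d - jt.+1 < k' beta)%N -> forall g, bdeg k' g ->
    lspan (fun v => residue_gen jt.+1 phi' v \/ partial_gen jt.+1 phi' k' v) g.
  rewrite dn jtE => phi'E chi_jt k'n; apply: IH => // [|j]; first by rewrite ltnW.
  rewrite -jtE ltnS leq_eqVlt => /orP[/eqP/val_inj -> //|jlt].
  by rewrite phi'E //; exact: chi_phi.
have chi_blocks beta : beta \in blocks jt -> chi jt beta by rewrite mem_blocks.
have ks beta : (d - jt.+1 + (beta \in blocks jt) < k beta)%N.
  by rewrite dn; apply: leq_ltn_trans (kn beta); rewrite -addn1 leq_add2l leq_b1.
apply: lspan_sub (partial_span_step step (blocks_uniq jt) chi_blocks ks gk) => v.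
case=> [[psi [apsi psi_phi _ ->]]|[vgen|[h [k' [hk' kk' ->]]]]]; last 2 first.
- by right.
- right; right; exists jt, h, k'; split=> // beta.
  by rewrite -mem_blocks.
- by left; exists psi; split=> //; rewrite -(residueS jt psi).
Qed.

Definition assignments := {psi : {ffun 'I_d -> B} | assignment psi}.

Lemma product_system_span k : (forall beta, d < k beta)%N ->
  spans_at b chi (fun psi : assignments => residue 0 (val psi)) product_system k.
Proof.
move=> kd g gk; have kd0 beta : (d - 0 < k beta)%N by rewrite subn0.
(* For [t = 0] nothing is prescribed, so [b] can stand for [phi]. *)
have chi0 (j : 'I_d) : (j < 0)%N -> chi j (b j) by [].
apply: lspan_sub (partial_span (leq0n d) chi0 kd0 gk) => v.
case=> [[psi [apsi _ ->]]|[[j [h [k' []]]] //|[j [h [k' [_ hk' kk' ->]]]]]].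
  by left; exists (exist _ psi apsi).
by right; exists j, h, k'.
Qed.

End ProductSystem.

(** Places the zeros of the product system in the torus: their coordinates are such coefficients. *)
Lemma coef_prod_gt0 (K : numDomainType) (I : eqType) (s : seq I) (c : I -> K) i :
  (forall j, 0 < c j) -> (i <= size s)%N ->
  0 < (\prod_(j <- s) (1 + c j *: 'X))`_i.
Proof.
move=> c0; pose q s : {poly K} := \prod_(j <- s) (1 + c j *: 'X).
have qS j s' n : (q (j :: s'))`_n = (q s')`_n + c j * (if n is n'.+1 then (q s')`_n' else 0).
  rewrite /q big_cons mulrDl mul1r coefD -scalerAl coefZ coefXM.
  by case: n.
have q_ge0 s' n : 0 <= (q s')`_n.
  elim: s' n => [|j s' IH] n; first by rewrite /q big_nil coef1 ler0n.
  rewrite qS; apply: addr_ge0; first exact: IH.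
  apply: mulr_ge0; first exact/ltW.
  by case: n => [|n]; rewrite ?lexx ?IH.
rewrite -/(q s); elim: s i => [|j s IH] i; first by rewrite /q big_nil coef1; case: i.
rewrite qS /= => lei; case: i lei => [|i] lei; first by rewrite mulr0 addr0 IH.
by apply: ltr_wpDl; [exact: q_ge0|apply: mulr_gt0; [|exact: IH]].
Qed.

(** * Zeros of the product system *)

Section ProductZeros.
Variables (C : numClosedFieldType) (d : nat) (B : finType) (b : 'I_d -> B).
Variable chi : 'I_d -> pred B.
Implicit Types (psi : assignments b chi).
Local Notation node := (@node C d).
Local Notation block := (block b).
Local Notation pos := (pos b).
Local Notation moment_form := (@moment_form C d B b).
Local Notation product_system := (product_system C b chi).

Lemma assignmentP psi j : chi j (val psi j).
Proof. by case: psi => psi /= /andP[/forallP]. Qed.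

Lemma assignment_balanced psi beta : #|[pred j | val psi j == beta]| = #|block beta|.
Proof. by case: psi => psi /= /andP[_ /forallP/(_ beta)/eqP]. Qed.

(** Has constant term 1 and, as roots, the nodes of the equations assigned to [beta]. *)
Definition zero_poly psi beta : {poly C} :=
  \prod_(j <- enum [pred j | val psi j == beta]) (1 + j.+1%:R^-1 *: 'X).

Definition product_zero psi (l : 'I_d) : C := (zero_poly psi (b l))`_(pos l).

Lemma size_zero_poly psi beta : (size (zero_poly psi beta) <= #|block beta|.+1)%N.
Proof.
rewrite -(assignment_balanced psi) cardE /zero_poly.
elim: (enum _) => [|j s IH]; first by rewrite big_nil size_poly1.
rewrite big_cons; apply: leq_trans (size_polyMleq _ _) _.
have : (size (1 + j.+1%:R^-1 *: 'X : {poly C})%R <= 2)%N.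
  apply: leq_trans (size_polyD _ _) _; rewrite size_poly1 geq_max /=.
  by apply: leq_trans (size_scale_leq _ _) _; rewrite size_polyX.
by move=> H; rewrite -subn1 leq_subLR; exact: leq_trans (leq_add H IH) _.
Qed.

Lemma horner_zero_poly psi beta c :
  (zero_poly psi beta).[c] = \prod_(j | val psi j == beta) (1 + j.+1%:R^-1 * c).
Proof.
rewrite horner_prod big_enum /=; apply: eq_bigr => j _.
by rewrite !hornerE.
Qed.

(** At any point a moment form is, as a polynomial in [c], 1 plus the sum of the coordinates of the
    block times powers of [c]; the coordinates of [product_zero psi] are chosen to make this
    [zero_poly psi beta]. *)
Lemma moment_form_product_zero psi c beta :
  (moment_form c beta).@[product_zero psi] = (zero_poly psi beta).[c].
Proof.
rewrite (horner_coef_wide _ (size_zero_poly psi beta)) big_ord_recl expr0 mulr1.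
rewrite mevalD meval1 raddf_sum; congr (_ + _).
  rewrite -horner_coef0 horner_zero_poly big1 // => j _.
  by rewrite mulr0 addr0.
transitivity (\sum_(l <- enum (block beta)) c ^+ pos l * product_zero psi l).
  by rewrite big_enum; apply: eq_bigr => l _ /=; rewrite mevalZ mevalXU.
pose F i := (zero_poly psi beta)`_i * c ^+ i.
transitivity (\sum_(l <- enum (block beta)) F (index l (enum (block beta))).+1).
  rewrite big_seq [RHS]big_seq; apply: eq_bigr => l.
  by rewrite mem_enum inE => /eqP bl; rewrite /product_zero /pos bl mulrC.
case E : (enum (block beta)) => [|l0 s].
  rewrite big_nil big1 // => i _; suff : (i < 0)%N by [].
  by apply: leq_trans (ltn_ord i) _; rewrite cardE E.
rewrite -E (big_nth l0) big_mkord -cardE; apply: eq_bigr => i _.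
by rewrite index_uniq ?enum_uniq -?cardE.
Qed.

(** The roots of [zero_poly psi beta] are the nodes of the [j] with [psi j = beta], and nodes are
    distinct. Hence [psi] can be read off from its zero. *)
Lemma product_zero_root psi j beta :
  ((factor C b j beta).@[product_zero psi] == 0) = (val psi j == beta).
Proof.
rewrite moment_form_product_zero horner_zero_poly; apply/idP/idP => [|/eqP psij].
  rewrite prodf_seq_eq0 => /hasP[j' _ /andP[/eqP <-]].
  rewrite /node mulrN subr_eq0 => /eqP E.
  suff -> : j = j' by [].
  apply: (@node_inj C); congr (- _).
  apply: (@mulfI _ (j'.+1%:R^-1)); first by rewrite invr_eq0 pnatr_eq0.
  by rewrite -E mulVf // pnatr_eq0.
apply/eqP; rewrite (bigD1 j) ?psij //= mulrN mulVf ?pnatr_eq0 //.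
by rewrite subrr mul0r.
Qed.

Lemma product_zeroP psi j : (product_system j).@[product_zero psi] = 0.
Proof.
apply/eqP; rewrite rmorph_prod prodf_seq_eq0; apply/hasP.
exists (val psi j); first by rewrite mem_blocks assignmentP.
by rewrite /= product_zero_root.
Qed.

Lemma product_zero_inj : injective product_zero.
Proof.
move=> psi psi' E; apply/val_inj/ffunP => j.
have := product_zero_root psi j (val psi j); rewrite eqxx E product_zero_root.
by move=> /eqP.
Qed.

Lemma product_zero_neq0 psi l : product_zero psi l != 0.
Proof.
rewrite gt_eqF // coef_prod_gt0 // => [j|]; first by rewrite invr_gt0 ltr0n.
by rewrite -cardE assignment_balanced pos_le.
Qed.

End ProductZeros.

(** Takes [c l = t ^+ l]: for distinct [i] and [j] the difference of the two values is a nonzero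
    polynomial in [t], and some [t] avoids the roots of all of these. *)
Lemma separating_form (C : numClosedFieldType) (d : nat) (I : finType) (z : I -> 'I_d -> C) :
  injective z -> exists c : 'I_d -> C, injective (fun i => \sum_l c l * z i l).
Proof.
move=> z_inj.
pose q i j : {poly C} := \poly_(l < d) (if insub l is Some l then z i l - z j l else 0).
have [|t] := @poly_nonroot C (\prod_(ij : I * I | ij.1 != ij.2) q ij.1 ij.2).
  apply/prodf_neq0 => -[i j] /= ij; apply: contraNneq ij => qij.
  apply/eqP/z_inj/funext => l; apply/eqP; rewrite -subr_eq0.
  have := congr1 (fun q : {poly C} => q`_l) qij.
  by rewrite coef0 coef_poly ltn_ord valK => ->.
rewrite horner_prod prodf_seq_neq0 => /allP tP.
exists (fun l => t ^+ l) => i j E; apply: contrapT => /eqP ij.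
have := tP (i, j) (mem_index_enum _); rewrite /= ij /= => /eqP; apply.
rewrite horner_poly; apply/eqP.
under eq_bigr do rewrite valK.
rewrite (eq_bigr (fun l : 'I_d => t ^+ l * z i l - t ^+ l * z j l)); last first.
  by move=> l _; rewrite mulrC mulrBr.
by rewrite sumrB E subrr.
Qed.

(** * Powers of a separating form as generators of the quotient *)

Section PowerBasis.
Variables (C : numClosedFieldType) (d : nat) (B : finType) (b : 'I_d -> B).
Variable chi : 'I_d -> pred B.
Implicit Types (f : 'I_d -> {mpoly C[d]}) (g h u : {mpoly C[d]}) (k : B -> nat).
Local Notation bdeg := (bdeg b).
Local Notation ideal_gen := (ideal_gen b chi).
Local Notation spans_at := (spans_at b chi).

Lemma lspan_ideal_gen_root f k z g : (forall j, (f j).@[z] = 0) ->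
  lspan (ideal_gen f k) g -> g.@[z] = 0.
Proof.
move=> fz; elim=> [|a x y [j [h [k' [_ _ ->]]]] _ IH]; first by rewrite meval0.
by rewrite mevalD mevalZ mevalM fz mul0r mulr0 add0r.
Qed.

(** Let [A] express the powers of [u] by [E] modulo the ideal. Evaluation at the zeros shows that
    [A] times the matrix of values of [E] is a Vandermonde matrix with distinct nodes. So [A] is
    invertible, and each [E s] is a combination of the powers. *)
Lemma power_basis f (I : finType) (E : I -> {mpoly C[d]}) (z : I -> 'I_d -> C) u k :
  spans_at E f k -> (forall i j, (f j).@[z i] = 0) ->
  injective (fun i => u.@[z i]) -> (forall i : 'I_#|I|, bdeg k (u ^+ i)) ->
  spans_at (fun i : 'I_#|I| => u ^+ i) f k.
Proof.
move=> Ek zf u_inj uk.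
have /boolp.choice[c cP] : forall i : 'I_#|I|, exists c : I -> C,
    lspan (ideal_gen f k) (u ^+ i - \sum_s c s *: E s).
  move=> i; have [x [y [/lspan_finP[c ->] Iy uE]]] := lspan_or (Ek _ (uk i)).
  by exists c; rewrite uE addrAC subrr add0r.
pose A := \matrix_(i < #|I|, t < #|I|) c i (enum_val t).
pose Ev := \matrix_(s < #|I|, t < #|I|) (E (enum_val s)).@[z (enum_val t)].
have AV : A *m Ev = Vandermonde #|I| (\row_t u.@[z (enum_val t)]).
  apply/matrixP => i t; rewrite !mxE.
  under eq_bigr do rewrite !mxE.
  rewrite (big_enum_val_fin (fun s => c i s * (E s).@[z (enum_val t)])).
  have := lspan_ideal_gen_root (zf (enum_val t)) (cP i).
  rewrite mevalB => /eqP; rewrite subr_eq0 => /eqP; rewrite rmorphXn raddf_sum /= => ->.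
  by apply: eq_bigr => s _; rewrite mevalZ.
have Au : A \in unitmx.
  have : A *m Ev \in unitmx.
    rewrite AV unitmxE unitfE det_Vandermonde; apply/prodf_neq0 => i _.
    apply/prodf_neq0 => j ij; rewrite !mxE subr_eq0.
    by apply: contraTneq ij => /u_inj/enum_val_inj ->; rewrite ltnn.
  by rewrite unitmx_mul => /andP[].
have Espan s : lspan (fun v => (exists i : 'I_#|I|, v = u ^+ i) \/ ideal_gen f k v) (E s).
  have -> : E s = \sum_i invmx A (enum_rank s) i *: u ^+ i -
      \sum_i invmx A (enum_rank s) i *: (u ^+ i - \sum_s' c i s' *: E s').
    rewrite -sumrB.
    under eq_bigr do rewrite -scalerBr opprB addrC subrK scaler_sumr.
    rewrite exchange_big /=.
    transitivity (\sum_s' (enum_rank s == enum_rank s')%:R *: E s').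
      rewrite (bigD1 s) //= eqxx scale1r big1 ?addr0 // => s' s's.
      by rewrite (inj_eq enum_rank_inj) eq_sym (negPf s's) scale0r.
    apply: eq_bigr => s' _.
    have := congr1 (fun M : 'M_#|I| => M (enum_rank s) (enum_rank s')) (mulVmx Au).
    rewrite [RHS]mxE => <-; rewrite mxE scaler_suml; apply: eq_bigr => i _.
    by rewrite mxE enum_rankK scalerA.
  apply: lspanB; apply: lspan_sum => i _; apply: lspanZ.
    by apply: lspan_mem; left; exists i.
  by apply: lspan_sub (cP i) => v ?; right.
move=> g gk; apply: lspan_trans (Ek g gk) => v [[s ->]|Iv]; first exact: Espan.
by apply: lspan_mem; right.
Qed.

Lemma product_power_basis : let N := #|{: assignments b chi}| in
  exists (u : {mpoly C[d]}) (z : 'I_N -> 'I_d -> C),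
  [/\ bdeg (fun=> 1%N) u, injective (fun i => u.@[z i]),
      forall i j, (product_system C b chi j).@[z i] = 0, forall i l, z i l != 0 &
      forall k, (forall beta, d + N < k beta)%N ->
        spans_at (fun i : 'I_N => u ^+ i) (product_system C b chi) k].
Proof.
move=> N; have [c c_inj] := separating_form (@product_zero_inj C _ _ b chi).
pose u : {mpoly C[d]} := \sum_l c l *: 'X_l.
have u1 : bdeg (fun=> 1%N) u.
  apply: bdeg_sum => l _; apply/bdegZ/bdegX => beta.
  by rewrite blockdegU leq_b1.
have uE z : u.@[z] = \sum_l c l * z l.
  by rewrite raddf_sum; apply: eq_bigr => l _ /=; rewrite mevalZ mevalXU.
have u_inj : injective (fun psi : assignments b chi => u.@[product_zero C psi]).
  by move=> psi psi'; rewrite !uE => /c_inj.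
exists u, (fun i => product_zero C (enum_val i)); split=> //.
- by move=> i i' /u_inj/enum_val_inj.
- by move=> i j; exact: product_zeroP.
- by move=> i l; exact: product_zero_neq0.
(* Degree [d] is consumed by the peeling, and [N] leaves room for the powers of [u]. *)
move=> k kd; apply: power_basis u_inj _ => [|psi j|i].
- by apply: product_system_span => beta; apply: leq_ltn_trans (kd beta); exact: leq_addr.
- exact: product_zeroP.
have := @bdegXn C d B b (fun=> 1%N) u i u1; apply: bdegW => beta; rewrite muln1.
apply: leq_trans (ltnW (ltn_ord i)) _.
by apply: leq_trans (ltnW (kd beta)); exact: leq_addl.
Qed.

End PowerBasis.

(** * Systems whose quotient is generated by one element *)

Section Extension.
Variables (C : numClosedFieldType) (d : nat) (B : finType) (b : 'I_d -> B).
Variable chi : 'I_d -> pred B.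
Implicit Types (f : 'I_d -> {mpoly C[d]}) (g h u : {mpoly C[d]}) (k : B -> nat).
Local Notation bdeg := (bdeg b).
Local Notation blockdeg := (blockdeg b).
Local Notation ideal_gen := (ideal_gen b chi).
Local Notation spans_at := (spans_at b chi).

Lemma ideal_gen_mull f k k1 g v :
  bdeg k1 g -> ideal_gen f k v -> ideal_gen f (fun beta => k1 beta + k beta)%N (g * v).
Proof.
move=> gk1 [j [h [k' [hk' kk' ->]]]].
exists j, (g * h), (fun beta => k1 beta + k' beta)%N; split.
- exact: bdegM.
- by move=> beta; rewrite -addnA leq_add2l.
- by rewrite mulrCA.
Qed.

Lemma ideal_genW f k k' v : (forall beta, k beta <= k' beta)%N ->
  ideal_gen f k v -> ideal_gen f k' v.
Proof.
move=> kk' [j [h [k1 [hk1 k1k ->]]]]; exists j, h, k1; split=> // beta.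
exact: leq_trans (kk' beta).
Qed.

(** Passes from one degree bound to all larger ones: a variable of a block of excessive degree is
    split off, the rest is reduced by induction, and the products [E i * 'X_l] that arise are within
    [k1]. *)
Lemma spans_at_extend (I : Type) (E : I -> {mpoly C[d]}) f k1 k :
  spans_at E f k1 -> (forall i l, bdeg k1 (E i * 'X_l)) ->
  (forall beta, k1 beta <= k beta)%N -> spans_at E f k.
Proof.
move=> E1 EX k1k g gk; apply: lspan_trans (bdeg_lspan gk) => _ [m mk ->] {g gk}.
have [n] := ubnP (mdeg m); elim: n m k mk k1k => // n IH m k mk k1k; rewrite ltnS => mn.
have incl v : lspan (fun v => (exists i, v = E i) \/ ideal_gen f k1 v) v ->
    lspan (fun v => (exists i, v = E i) \/ ideal_gen f k v) v.
  apply: lspan_sub => w [Ew|Iw]; [by left|right].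
  exact: ideal_genW Iw.
have [m1|/forallPn[beta]] := boolP [forall beta, (blockdeg beta m <= k1 beta)%N].
  by apply/incl/E1/bdegX/forallP.
rewrite -ltnNge => m_beta.
have [l bl ml] : exists2 l, b l = beta & m l != 0%N.
  apply: contrapT => H; move: m_beta; rewrite /blockdeg big1 // => l /eqP bl.
  by apply: contrapT => /eqP ml; apply: H; exists l.
have mE : m = (m - U_(l) + U_(l))%MM by rewrite submK // lep1mP.
(* One degree in [beta] is reserved for the variable split off; [k1 <= k'] still holds because [m]
   exceeds [k1] there. *)
pose k' beta' := (k beta' - (beta' == beta))%N.
have m'k' beta' : (blockdeg beta' (m - U_(l))%MM <= k' beta')%N.
  have := mk beta'; rewrite {1}mE blockdegD blockdegU bl eq_sym /k'.
  lia.
have k1k' beta' : (k1 beta' <= k' beta')%N.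
  rewrite /k'; case: (eqVneq beta' beta) => [->|_] /=; last by rewrite subn0.
  by have := mk beta; lia.
have m'n : (mdeg (m - U_(l))%MM < n)%N.
  by apply: leq_trans mn; rewrite [in X in (_ < X)%N]mE mdegD mdeg1 addn1.
rewrite mE mpolyXD mulrC; apply: lspan_mull (IH _ k' m'k' k1k' m'n) => v [[i ->]|Iv].
  by rewrite mulrC; apply/incl/E1.
apply: lspan_mem; right.
have Xl : bdeg (fun beta' => (b l == beta') : nat) ('X_l : {mpoly C[d]}).
  by apply: bdegX => beta'; rewrite blockdegU.
apply: ideal_genW (ideal_gen_mull Xl Iv) => beta'.
rewrite bl eq_sym /k'; case: (eqVneq beta' beta) => [->|_] /=; last by rewrite subn0.
by have := mk beta; lia.
Qed.

(** Membership in the ideal involves finitely many cofactors, and a large enough degree bound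
    accommodates them all. *)
Lemma generated_ideal_bound f v : generated_ideal f v ->
  exists k0 : nat, forall k, (forall beta, k0 <= k beta)%N -> lspan (ideal_gen f k) v.
Proof.
elim=> [|a x y [j [h ->]] _ [k0 k0P]]; first by exists 0%N => k _; exact: lspan0.
exists (maxn k0 (msize h).+1) => k kk; apply: lspan_cons; last first.
  by apply: k0P => beta; apply: leq_trans (kk beta); exact: leq_maxl.
exists j, h, (fun=> msize h); split=> //; first exact: bdeg_msize.
move=> beta; apply: leq_trans (kk beta); apply: leq_trans (leq_maxr k0 _).
by rewrite -addn1 leq_add2l leq_b1.
Qed.

Lemma spans_at_all (I : Type) (E : I -> {mpoly C[d]}) f (k0 : nat) :
  (forall k, (forall beta, k0 <= k beta)%N -> spans_at E f k) ->
  forall g, lspan (fun v => (exists i, v = E i) \/ (exists j h, v = f j * h)) g.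
Proof.
move=> H g; have gk : bdeg (fun=> maxn k0 (msize g)) g.
  by apply: bdegW (@bdeg_msize _ _ _ b g) => beta; rewrite leq_maxr.
have kk beta : (k0 <= (fun _ : B => maxn k0 (msize g)) beta)%N by rewrite leq_maxl.
apply: lspan_sub (H _ kk g gk) => v [Ev|[j [h [k' [_ _ ->]]]]]; first by left.
by right; exists j, h.
Qed.

End Extension.

Section Quotient.
Variables (C : numClosedFieldType) (d : nat).
Implicit Types (f : 'I_d -> {mpoly C[d]}) (g h u : {mpoly C[d]}) (q : {poly C}).

Lemma generated_ideal_root f z g : (forall j, (f j).@[z] = 0) ->
  generated_ideal f g -> g.@[z] = 0.
Proof.
move=> fz; elim=> [|a x y [j [h ->]] _ IH]; first by rewrite meval0.
by rewrite mevalD mevalZ mevalM fz mul0r mulr0 add0r.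
Qed.

Lemma meval_horner_alg u q z : (horner_alg u q).@[z] = q.[u.@[z]].
Proof.
elim/poly_ind: q => [|q c IH]; first by rewrite rmorph0 meval0 horner0.
rewrite rmorphD rmorphM /= horner_algX horner_algC mevalD mevalM IH.
by rewrite -mul_mpolyC mulr1 mevalC !hornerE.
Qed.

(** The derivative of [g] at [z] in the direction [v]. *)
Definition gradient g (z v : 'I_d -> C) := \sum_l g^`M(l).@[z] * v l.

Lemma gradientM g h z v :
  gradient (g * h) z v = gradient g z v * h.@[z] + g.@[z] * gradient h z v.
Proof.
rewrite /gradient mulr_suml mulr_sumr -big_split; apply: eq_bigr => l _ /=.
by rewrite mderivM mevalD !mevalM mulrDl mulrAC mulrA.
Qed.

Lemma gradientD g h z v : gradient (g + h) z v = gradient g z v + gradient h z v.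
Proof.
rewrite /gradient -big_split; apply: eq_bigr => l _ /=.
by rewrite mderivD mevalD mulrDl.
Qed.

Lemma gradientC c z v : gradient c%:MP z v = 0.
Proof. by rewrite /gradient big1 // => l _; rewrite mderivC meval0 mul0r. Qed.

Lemma gradientXU l z v : gradient 'X_l z v = v l.
Proof.
rewrite /gradient (bigD1 l) //= mderivX mnm1E eqxx scale1r.
rewrite (_ : (U_(l) - U_(l))%MM = 0%MM) ?mpolyX0 ?meval1 ?mul1r; last first.
  by apply/mnmP => i; rewrite mnmBE mnm0E subnn.
rewrite big1 ?addr0 // => i il.
by rewrite mderivX mnm1E eq_sym (negPf il) scale0r meval0 mul0r.
Qed.

Lemma generated_ideal_gradient f z v g :
  (forall j, (f j).@[z] = 0) -> (forall j, gradient (f j) z v = 0) ->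
  generated_ideal f g -> gradient g z v = 0.
Proof.
move=> fz fv; elim=> [|a x y [j [h ->]] _ IH]; first by rewrite -(gradientC 0 z v).
by rewrite gradientD IH addr0 -mul_mpolyC !gradientM gradientC fv fz !(mul0r, addr0, mulr0).
Qed.

(** The composite of [g] with the parametrised curve [x]. *)
Definition curve (x : 'I_d -> {poly C}) g : {poly C} := mmap polyC x g.

HB.instance Definition _ x := GRing.RMorphism.copy (curve x) (mmap polyC x).

Lemma curveC x c : curve x c%:MP = c%:P.
Proof. exact: mmapC. Qed.

Lemma curveXU x l : curve x 'X_l = x l.
Proof. by rewrite /curve mmapX mmap1U. Qed.

Lemma horner_curve x g t : (curve x g).[t] = g.@[fun l => (x l).[t]].
Proof.
elim/mpoly_ring_ind: g => [c|l|g h IHg IHh|g h IHg IHh].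
- by rewrite curveC hornerC mevalC.
- by rewrite curveXU mevalXU.
- by rewrite rmorphD hornerD IHg IHh mevalD.
- by rewrite rmorphM hornerM IHg IHh mevalM.
Qed.

Lemma deriv_curve x g t :
  (curve x g)^`().[t] = gradient g (fun l => (x l).[t]) (fun l => (x l)^`().[t]).
Proof.
elim/mpoly_ring_ind: g => [c|l|g h IHg IHh|g h IHg IHh].
- by rewrite curveC derivC horner0 gradientC.
- by rewrite curveXU gradientXU.
- by rewrite rmorphD derivD hornerD IHg IHh gradientD.
- by rewrite rmorphM derivM hornerD !hornerM IHg IHh !horner_curve gradientM.
Qed.

Lemma power_rep f u N g :
  (forall g, lspan (fun v => (exists i : 'I_N, v = u ^+ i) \/ (exists j h, v = f j * h)) g) ->
  exists q, (size q <= N)%N /\ generated_ideal f (g - horner_alg u q).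
Proof.
move=> span; have [x [y [/lspan_finP[c ->] Iy gE]]] := lspan_or (span g).
exists (\sum_i c i *: 'X^i); split.
  apply: leq_trans (size_sum _ _ _) _; apply/bigmax_leqP => i _.
  by apply: leq_trans (size_scale_leq _ _) _; rewrite size_polyXn.
rewrite gE rmorph_sum addrAC -sumrB big1 ?add0r // => i _ /=.
by rewrite horner_algZ rmorphXn /= horner_algX mul_mpolyC subrr.
Qed.

(* When the powers of [u] form a basis of the quotient by the ideal of [f], the
   quotient is [C[X]/(char)] for the minimal polynomial [char] of [u], and the zeros of
   [f] correspond to the roots of [char].  A tangent vector to the curve
   [t |-> x(t)] at a multiple root of [char] would be a nonzero kernel vector of
   the Jacobian matrix of [f]. *)
Lemma monogenic_solutions f u N :
  (forall g, lspan (fun v => (exists i : 'I_N, v = u ^+ i) \/ (exists j h, v = f j * h)) g) ->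
  (forall q, (size q <= N)%N -> generated_ideal f (horner_alg u q) -> q = 0) ->
  (forall z v, (forall j, (f j).@[z] = 0) -> (forall j, gradient (f j) z v = 0) ->
    forall l, v l = 0) ->
  exists z : 'I_N -> 'I_d -> C, injective z /\
    forall x, solutions f x <-> exists i, x = z i.
Proof.
move=> span free tangent; set I := generated_ideal f.
have Iid : is_ideal I := is_ideal_generated f; have [I0 ID IM] := Iid.
have rep g : exists q, (size q <= N)%N /\ I (g - horner_alg u q) by exact: power_rep.
have [qN [sqN IqN]] := rep (u ^+ N).
pose char := 'X^N - qN : {poly C}.
have size_char : size char = N.+1 by rewrite size_polyDl ?size_polyXn // size_polyN ltnS.
have char_neq0 : char != 0 by rewrite -size_poly_gt0 size_char.
have char_dvd q : I (horner_alg u q) <-> char %| q.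
  have Ichar : I (horner_alg u char) by rewrite rmorphB rmorphXn /= horner_algX.
  split=> [Iq|/dvdpP[q' ->]]; last by rewrite rmorphM /=; exact: IM.
  apply/modp_eq0P/free; first by rewrite -ltnS -size_char ltn_modp.
  have := idealB Iid Iq (IM _ (horner_alg u (q %/ char)) Ichar).
  by rewrite {1}(divp_eq q char) rmorphD rmorphM /= addrAC subrr add0r.
clearbody char; have /boolp.choice[x /all_and2[sx Ix]] := fun l => rep 'X_l.
(* Modulo the ideal, ['X_l] is [x l] evaluated at [u], hence any [g] is its composite with the
   curve, evaluated at [u]. *)
have curve_I g : I (g - horner_alg u (curve x g)).
  elim/mpoly_ring_ind: g => [c|l|g h IHg IHh|g h IHg IHh].
  - by rewrite curveC horner_algC -mul_mpolyC mulr1 subrr.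
  - by rewrite curveXU.
  - by rewrite !rmorphD /= opprD addrACA; exact: ID.
  - rewrite !rmorphM /=; have := ID _ _ (IM _ h IHg) (IM _ (horner_alg u (curve x g)) IHh).
    by congr I; ring.
have curve_dvd g : I g -> char %| curve x g.
  move=> Ig; apply/char_dvd; have := idealB Iid Ig (curve_I g).
  by rewrite opprB addrC subrK.
have curve_u : char %| curve x u - 'X.
  by apply/char_dvd; rewrite rmorphB /= horner_algX -opprB; apply: idealN => //; exact: curve_I.
pose zt t l := (x l).[t].
have zt_root t : root char t -> forall j, (f j).@[zt t] = 0.
  move=> ct j; rewrite -horner_curve; apply/rootP/(root_dvdp _ ct)/curve_dvd.
  by apply: lspan_mem; exists j, 1; rewrite mulr1.
have zt_u t : root char t -> u.@[zt t] = t.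
  move=> /(root_dvdp curve_u)/rootP; rewrite !hornerE horner_curve => /eqP.
  by rewrite subr_eq0 => /eqP.
have simple t : root char t -> char^`().[t] != 0.
  move=> ct; apply/negP => /eqP c't.
  have dvd' F : char %| F -> F^`().[t] = 0.
    by move=> /dvdpP[G ->]; rewrite derivM !hornerE (rootP ct) c't !mulr0 addr0.
  have v0 := tangent (zt t) (fun l => (x l)^`().[t]) (zt_root t ct).
  have {}v0 l : (x l)^`().[t] = 0.
    apply: v0 => j; rewrite -deriv_curve; apply/dvd'/curve_dvd.
    by apply: lspan_mem; exists j, 1; rewrite mulr1.
  (* [curve x u - 'X] is divisible by [char], so its derivative vanishes at the multiple root; but
     with zero tangent vector this derivative is -1. *)
  have := dvd' _ curve_u; rewrite derivB derivX hornerD hornerN hornerC deriv_curve.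
  rewrite /gradient big1 => [|l _]; last by rewrite v0 mulr0.
  by move/eqP; rewrite sub0r oppr_eq0 oner_eq0.
have [r charE] := closed_field_poly_normal char.
have lc0 : lead_coef char != 0 by rewrite lead_coef_eq0.
have mem_r t : (t \in r) = root char t by rewrite charE rootZ // root_prod_XsubC.
have ur : uniq r.
  rewrite -separable_prod_XsubC unlock -(coprimepZl _ _ lc0) -charE.
  have -> : (\prod_(z <- r) ('X - z%:P))^`() = (lead_coef char)^-1 *: char^`().
    by rewrite {2}charE derivZ scalerA mulVf // scale1r.
  rewrite coprimepZr ?invr_neq0 //; apply/Pdiv.ClosedField.coprimepP => t ct.
  exact: simple.
have sr : size r = N.
  by have := size_char; rewrite charE size_scale // size_prod_XsubC => -[].
have rP (i : 'I_N) : root char r`_i by rewrite -mem_r mem_nth ?sr.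
exists (fun i => zt r`_i); split.
  move=> i j /(congr1 (fun z => u.@[z])); rewrite !zt_u // => /eqP.
  by rewrite nth_uniq ?sr // => /eqP/val_inj.
move=> x0; split=> [x0f|[i ->]]; last exact/zt_root/rP.
have u_root : root char u.@[x0].
  apply/rootP; rewrite -meval_horner_alg.
  by apply: generated_ideal_root x0f _; apply/char_dvd.
have lt_N : (index u.@[x0] r < N)%N by rewrite -sr index_mem mem_r.
exists (Ordinal lt_N); apply/funext => l.
rewrite /= nth_index ?mem_r // /zt; apply/eqP; rewrite -subr_eq0.
rewrite -meval_horner_alg -[x0 l](mevalXU x0) -mevalB; apply/eqP.
exact: generated_ideal_root x0f (Ix l).
Qed.

End Quotient.

(** * Counting zeros *)

Section Jacobian.
Variables (C : numClosedFieldType) (d : nat).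
Implicit Types (f : 'I_d -> {mpoly C[d]}) (z v : 'I_d -> C).

Definition jacobian f : {mpoly C[d]} := \det (\matrix_(j, l) (f j)^`M(l)).

Lemma meval_jacobian f z :
  (jacobian f).@[z] = \det (\matrix_(j, l) ((f j)^`M(l)).@[z]).
Proof.
rewrite /jacobian -[LHS]det_map_mx; congr (\det _).
by apply/matrixP => j l; rewrite !mxE.
Qed.

Lemma jacobian_neq0P f z :
  (jacobian f).@[z] != 0 <->
  (forall v, (forall j, gradient (f j) z v = 0) -> forall l, v l = 0).
Proof.
rewrite meval_jacobian; set A := \matrix_(j, l) _; split=> [A0 v fv l|inj].
  have Au : A \in unitmx by rewrite unitmxE unitfE.
  have Av : A *m (\col_l v l) = 0.
    apply/matrixP => j i; rewrite [RHS]mxE -[RHS](fv j) mxE.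
    by apply: eq_bigr => l' _; rewrite !mxE.
  have := mulKmx Au (\col_l v l); rewrite Av mulmx0 => /(congr1 (fun M : 'cV_d => M l 0)).
  by rewrite !mxE.
rewrite -det_tr; apply/negP => /det0P[v v0 vA]; case/negP: v0; apply/eqP/rowP => l.
rewrite [RHS]mxE; apply: (inj (fun l => v 0 l)) => j.
have := congr1 (fun M : 'rV_d => M 0 j) vA; rewrite !mxE => <-.
by apply: eq_bigr => l' _; rewrite !mxE mulrC.
Qed.

(* Invertible modulo the ideal of f when the zeros of f are simple and lie in
   the torus. *)
Definition torus_jacobian f : {mpoly C[d]} := jacobian f * \prod_l 'X_l.

Lemma torus_jacobian_neq0 f z :
  (torus_jacobian f).@[z] != 0 <-> (jacobian f).@[z] != 0 /\ forall l, z l != 0.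
Proof.
rewrite mevalM mulf_eq0 negb_or rmorph_prod /=.
split=> [/andP[J0 /prodf_neq0 z0]|[J0 z0]].
  by split=> // l; have := z0 l isT; rewrite mevalXU.
by apply/andP; split=> //; apply/prodf_neq0 => l _; rewrite mevalXU.
Qed.

Variables (B : finType) (b : 'I_d -> B) (chi : 'I_d -> pred B).

Lemma bdeg_torus_jacobian f : sparse b chi f ->
  bdeg b (fun=> d + d)%N (torus_jacobian f).
Proof.
move=> sf; apply: bdegM.
  have J1 (j l : 'I_d) : bdeg b (fun=> 1%N) ((\matrix_(j, l) (f j)^`M(l)) j l).
    rewrite mxE; apply: bdeg_mderiv; apply: bdegW (sf j) => beta.
    exact: leq_b1.
  by have := bdeg_det J1; apply: bdegW => beta; rewrite muln1.
have X1 (l : 'I_d) (_ : true) : bdeg b (fun=> 1%N) ('X_l : {mpoly C[d]}).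
  by apply: bdegX => beta; rewrite blockdegU leq_b1.
have := bdeg_prod X1 (r := index_enum 'I_d); apply: bdegW => beta.
by rewrite sum1_card card_ord.
Qed.

Lemma poly_family_torus_jacobian : poly_family b chi torus_jacobian.
Proof.
apply: poly_familyM (poly_family_const _ _ _).
apply: poly_family_det => j l; apply: poly_family_mderiv.
exact: poly_family_id.
Qed.

End Jacobian.

Lemma horner_alg_powers (C : numClosedFieldType) d (u : {mpoly C[d]}) (q : {poly C}) :
  horner_alg u q = \sum_(i < size q) q`_i *: u ^+ i.
Proof.
rewrite -{1}[q]coefK poly_def rmorph_sum; apply: eq_bigr => i _ /=.
by rewrite horner_algZ rmorphXn /= horner_algX mul_mpolyC.
Qed.

Section Count.
Variables (C : numClosedFieldType) (d : nat) (B : finType) (b : 'I_d -> B).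
Variable chi : 'I_d -> pred B.
Implicit Types (f : 'I_d -> {mpoly C[d]}) (g h u : {mpoly C[d]}) (k : B -> nat).
Local Notation bdeg := (bdeg b).
Local Notation sparse := (sparse b chi).
Local Notation ideal_gen := (ideal_gen b chi).
Local Notation spans_at := (spans_at b chi).
Local Notation generic := (generic b chi).
Local Notation N := #|{: assignments b chi}|.

(** [fiber_bound] with the product system as reference: its quotient is spanned by [N] powers of
    [u]. *)
Lemma zero_count_bound (C_unc : uncountable_field C) f n (z : 'I_n -> 'I_d -> C) :
  sparse f -> zero_dimensional f -> injective z -> (forall i j, (f j).@[z i] = 0) ->
  (n <= N)%N.
Proof.
move=> sf fin_f z_inj zf.
have [D [e e_span]] := finite_solutions_quotient C_unc fin_f.
have [u [_ [u1 _ _ _ pspan]]] := product_power_basis C b chi.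
pose k (_ : B) := ((d + N).+1 + \max_a msize (e a))%N.
apply: (@fiber_bound C d B b chi (product_system C b chi) f k N D n (fun i => u ^+ i) e z) => //.
- exact: sparse_product_system.
- move=> i; have := @bdegXn C d B b (fun=> 1%N) u i u1; apply: bdegW => beta.
  rewrite muln1 /k; apply: leq_trans (ltnW (ltn_ord i)) _.
  by apply: leq_trans (leq_addr _ _); apply/leqW/leq_addl.
- by apply: pspan => beta; rewrite /k addSn ltnS leq_addr.
- move=> a; apply: bdegW (@bdeg_msize _ _ _ b (e a)) => beta.
  by rewrite /k; apply: leq_trans (leq_addl _ _); exact: (leq_bigmax (F := fun a => msize (e a))).
Qed.

(* A relation of degree less than M between the powers of u modulo f would let
   M - 1 of them generate, while p has M zeros. *)
Lemma powers_free p f u M (kp kf : nat) (z : 'I_M -> 'I_d -> C) (q : {poly C}) :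
  sparse p -> sparse f -> bdeg (fun=> 1%N) u ->
  (forall k, (forall beta, kp <= k beta)%N -> spans_at (fun i : 'I_M => u ^+ i) p k) ->
  (forall k, (forall beta, kf <= k beta)%N -> spans_at (fun i : 'I_M => u ^+ i) f k) ->
  injective z -> (forall i j, (p j).@[z i] = 0) ->
  (size q <= M)%N -> generated_ideal f (horner_alg u q) -> q = 0.
Proof.
move=> sp sf u1 pspan fspan z_inj pz sq Iq; apply: contrapT => /eqP q0.
have [k0 k0P] := generated_ideal_bound b chi Iq.
pose s := (size q).-1; have sE : size q = s.+1 by rewrite prednK // lt0n size_poly_eq0.
pose k (_ : B) := (k0 + kf + M)%N.
have uk i : (i <= M)%N -> bdeg k (u ^+ i).
  move=> iM; have := @bdegXn C d B b (fun=> 1%N) u i u1; apply: bdegW => beta.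
  by rewrite muln1 /k; lia.
have : (M <= M.-1)%N; last by have := sq; rewrite sE; lia.
(* [bump s] skips the exponent [s], the degree of [q]: the relation expresses [u ^+ s] by lower
   powers. *)
have bumpM (i : 'I_M.-1) : (bump s i < M)%N.
  by rewrite /bump; have := ltn_ord i; case: leqP => /=; lia.
apply: (@fiber_bound C d B b chi f p k M.-1 M M (fun i => u ^+ bump s i)
  (fun i => u ^+ i) z) => //.
- by move=> i; apply: uk; exact/ltnW.
- have lspan_other (i : nat) : (i < M)%N -> i != s ->
      lspan (fun v => (exists i : 'I_M.-1, v = u ^+ bump s i) \/ ideal_gen f k v) (u ^+ i).
    move=> iM i_s; have lt_i : (unbump s i < M.-1)%N.
      by rewrite /unbump; move: i_s; rewrite neq_ltn; case: ltnP => /=; lia.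
    by apply: lspan_mem; left; exists (Ordinal lt_i); rewrite /= unbumpKcond (negPf i_s).
  have lspan_s : lspan (fun v => (exists i : 'I_M.-1, v = u ^+ bump s i) \/ ideal_gen f k v)
      (u ^+ s).
    have lc0 : q`_s != 0 by rewrite -lead_coefE lead_coef_eq0.
    have -> : u ^+ s = (q`_s)^-1 *: horner_alg u q -
        \sum_(i < s) ((q`_s)^-1 * q`_i) *: u ^+ i.
      rewrite horner_alg_powers sE big_ord_recr /= scalerDr scalerA mulVf // scale1r.
      rewrite scaler_sumr addrAC -sumrB big1 ?add0r // => i _.
      by rewrite scalerA subrr.
    apply: lspanB; last first.
      apply: lspan_sum => i _; apply: lspanZ; apply: lspan_other.
        by apply: leq_trans (ltn_ord i) _; rewrite -ltnS -sE ltnW.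
      by rewrite neq_ltn ltn_ord.
    apply: lspanZ; apply: lspan_sub (k0P k _) => [v ?|beta]; first by right.
    by rewrite /k; lia.
  move=> g gk; have kfk beta : (kf <= k beta)%N by rewrite /k; lia.
  apply: lspan_trans (fspan k kfk g gk) => v [[i ->]|Iv].
    by have [->|] := eqVneq (i : nat) s; last exact: lspan_other.
  by apply: lspan_mem; right.
- by move=> i; apply: uk; exact/ltnW.
- exact: spans_at_all pspan.
Qed.

Lemma power_quotient_root0 u M (z : 'I_M -> 'I_d -> C) (q : {poly C}) :
  injective (fun i => u.@[z i]) ->
  (size q <= M)%N -> (forall i, (horner_alg u q).@[z i] = 0) -> q = 0.
Proof.
move=> u_inj sq qz; apply: contrapT => /eqP q0.
have := @max_poly_roots _ q [seq u.@[z i] | i <- enum 'I_M] q0.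
rewrite size_map size_enum_ord ltnNge sq => H; suff: false by [].
apply: H; last by rewrite map_inj_uniq ?enum_uniq.
by apply/allP => _ /mapP[i _ ->]; apply/rootP; rewrite -meval_horner_alg.
Qed.

(** Modulo the ideal, [g] is a polynomial [q] of degree less than [M] in [u], and [q] has the [M]
    distinct roots [u.@[z i]]. *)
Lemma power_quotient_radical f u M (z : 'I_M -> 'I_d -> C) g :
  (forall g, lspan (fun v => (exists i : 'I_M, v = u ^+ i) \/ (exists j h, v = f j * h)) g) ->
  injective (fun i => u.@[z i]) -> (forall i j, (f j).@[z i] = 0) ->
  (forall i, g.@[z i] = 0) -> generated_ideal f g.
Proof.
move=> span u_inj fz gz; have [q [sq Iq]] := power_rep g span.
suff q0 : q = 0 by move: Iq; rewrite q0 rmorph0 subr0.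
apply: power_quotient_root0 u_inj sq _ => i; apply/eqP.
have := generated_ideal_root (fz i) Iq; rewrite mevalB gz sub0r => /eqP.
by rewrite oppr_eq0.
Qed.

(** With [w] vanishing at the other zeros, [('X_l - (z i l)%:MP) * w] vanishes at all of them, so it
    is in the ideal. Its derivative at [z i] along a kernel vector [v] is [v l] times the nonzero
    value of [w], and must be 0. *)
Lemma power_quotient_jacobian f u M (z : 'I_M -> 'I_d -> C) i :
  (forall g, lspan (fun v => (exists i : 'I_M, v = u ^+ i) \/ (exists j h, v = f j * h)) g) ->
  injective (fun i => u.@[z i]) -> (forall i j, (f j).@[z i] = 0) ->
  (jacobian f).@[z i] != 0.
Proof.
move=> span u_inj fz; apply/jacobian_neq0P => v fv l.
pose w : {mpoly C[d]} := \prod_(j | j != i) (u - (u.@[z j])%:MP).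
have Iw : generated_ideal f (('X_l - (z i l)%:MP) * w).
  apply: power_quotient_radical span u_inj fz _ => j; rewrite mevalM.
  have [->|ji] := eqVneq j i; first by rewrite mevalB mevalXU mevalC subrr mul0r.
  rewrite [X in _ * X](_ : _ = 0) ?mulr0 // rmorph_prod (bigD1 j) //=.
  by rewrite mevalB mevalC subrr mul0r.
have := generated_ideal_gradient (fz i) fv Iw; rewrite gradientM -mpolyCN gradientD gradientXU.
rewrite gradientC addr0 mevalD mevalXU mevalC subrr mul0r addr0 => /eqP.
rewrite mulf_eq0 => /orP[/eqP //|]; rewrite rmorph_prod prodf_seq_eq0.
case/hasP=> j _ /andP[ji]; rewrite /= mevalB mevalC subr_eq0.
by move=> /eqP/u_inj ij; rewrite ij eqxx in ji.
Qed.

Lemma lagrange_mpoly u M (z : 'I_M -> 'I_d -> C) (c : 'I_M -> C) :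
  injective (fun i => u.@[z i]) -> exists w : {mpoly C[d]}, forall i, w.@[z i] = c i.
Proof.
move=> u_inj.
pose L i : {mpoly C[d]} := \prod_(j | j != i) (u - (u.@[z j])%:MP).
exists (\sum_i (c i / (L i).@[z i])%:MP * L i) => i.
rewrite raddf_sum (bigD1 i) //= big1 ?addr0 => [|j ji]; last first.
  rewrite mevalM [X in _ * X](_ : _ = 0) ?mulr0 // rmorph_prod (bigD1 i) 1?eq_sym //=.
  by rewrite mevalB mevalC subrr mul0r.
rewrite mevalM mevalC divfK // rmorph_prod; apply/prodf_neq0 => j ji /=.
rewrite mevalB mevalC subr_eq0; apply: contraNneq ji => /u_inj ->.
exact: eqxx.
Qed.

(** The torus Jacobian is nonzero at all the zeros, so interpolation gives an inverse [w] modulo the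
    ideal. Stated as a spanning property in bounded degree, this invertibility can be transferred to
    generic systems. *)
Lemma torus_jacobian_spans f u M (z : 'I_M -> 'I_d -> C) (kf : nat) :
  sparse f -> bdeg (fun=> 1%N) u ->
  (forall k, (forall beta, kf <= k beta)%N -> spans_at (fun i : 'I_M => u ^+ i) f k) ->
  injective (fun i => u.@[z i]) -> (forall i j, (f j).@[z i] = 0) ->
  (forall i l, z i l != 0) ->
  exists K : nat, spans_at (fun m : 'X_{1..d < degbound (fun _ : B => K)} =>
    if [forall beta, (blockdeg b beta m + (d + d) <= K)%N]
    then torus_jacobian f * 'X_[m] else 0) f (fun=> K).
Proof.
move=> sf u1 fspan u_inj fz z0.
have span := spans_at_all fspan.
have Uz i : (torus_jacobian f).@[z i] != 0.
  apply/torus_jacobian_neq0; split=> //.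
  exact: power_quotient_jacobian span u_inj fz.
have [w wz] := lagrange_mpoly (fun i => (torus_jacobian f).@[z i]^-1) u_inj.
have Iw : generated_ideal f (1 - torus_jacobian f * w).
  apply: power_quotient_radical span u_inj fz _ => i.
  by rewrite mevalB meval1 mevalM wz divff // subrr.
have [k0 k0P] := generated_ideal_bound b chi Iw.
(* The summands leave room for the reduction to powers of [u], for the ideal element
   [1 - torus_jacobian f * w] times [u ^+ i], and for the multiples of the torus Jacobian. *)
pose K := (kf + (k0 + M) + (msize w + M + (d + d)))%N.
have uk (i : 'I_M) : bdeg (fun=> M) (u ^+ i).
  have := @bdegXn C d B b (fun=> 1%N) u i u1; apply: bdegW => beta.
  by rewrite muln1 ltnW.
exists K => g gK.
have kfK (beta : B) : (kf <= (fun=> K) beta)%N by rewrite /K -addnA leq_addr.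
apply: lspan_trans (fspan _ kfK g gK) => v [[i ->]|Iv]; last first.
  by apply: lspan_mem; right.
have -> : u ^+ i = torus_jacobian f * (w * u ^+ i) + u ^+ i * (1 - torus_jacobian f * w).
  by ring.
apply: lspanD.
  have wk : bdeg (fun=> msize w + M)%N (w * u ^+ i) by apply: bdegM; [exact: bdeg_msize|exact: uk].
  apply: lspan_mull (bdeg_lspan wk) => _ [m mk ->].
  have mK beta : (blockdeg b beta m <= K)%N by have := mk beta; rewrite /K; lia.
  apply: lspan_mem; left; exists (BMultinom (mdeg_degbound (k := fun=> K) mK)) => /=.
  case: ifP => // /forallP[] beta; have := mk beta; rewrite /K; lia.
have k0K (beta : B) : (k0 <= (fun=> k0) beta)%N by [].
apply: lspan_mull (k0P _ k0K) => y Iy; apply: lspan_mem; right.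
by apply: ideal_genW (ideal_gen_mull (uk i) Iy) => beta; rewrite /K; lia.
Qed.

(** Two spanning properties of the product system persist generically: that of the powers of [u],
    and that of the multiples of the torus Jacobian. The latter makes all zeros simple and puts them
    in the torus. *)
Lemma generic_torus_count : generic (fun f => exists z : 'I_N -> 'I_d -> C,
  injective z /\ forall x, torus_solutions f x <-> exists i, x = z i).
Proof.
have sp := @sparse_product_system C d B b chi.
have [u [z [u1 u_inj pz z0 pspan]]] := product_power_basis C b chi.
have z_inj : injective z by move=> i j ij; apply: u_inj; rewrite /= ij.
(* One more than the bound [d + N] used for the powers, so that [u ^+ i * 'X_l] stays within
   [k1]. *)
pose k1 := (d + N).+1.
have {}pspan k : (forall beta, k1 <= k beta)%N ->
  spans_at (fun i : 'I_N => u ^+ i) (product_system C b chi) k by exact: pspan.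
have [K pK] := torus_jacobian_spans sp u1 pspan u_inj pz z0.
have uX (i : 'I_N) : bdeg (fun=> (d + N)%N) (u ^+ i).
  have := @bdegXn C d B b (fun=> 1%N) u i u1; apply: bdegW => beta.
  by rewrite muln1; apply: leq_trans (ltnW (ltn_ord i)) _; exact: leq_addl.
have gen1 : generic (fun f => spans_at (fun i : 'I_N => u ^+ i) f (fun=> k1)).
  apply: (generic_spans_at (E := fun (i : 'I_N) _ => u ^+ i) sp).
  - by move=> i; exact: poly_family_const.
  - by move=> i f sf; apply: bdegW (uX i) => beta; rewrite /k1.
  - exact: pspan.
pose E (m : 'X_{1..d < degbound (fun _ : B => K)}) f : {mpoly C[d]} :=
  if [forall beta, (blockdeg b beta m + (d + d) <= K)%N]
  then torus_jacobian f * 'X_[m] else 0.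
have gen2 : generic (fun f => spans_at (E^~ f) f (fun=> K)).
  apply: (generic_spans_at sp _ _ pK) => [m|m f sf]; rewrite /E.
    case: [forall beta, _]; last exact: poly_family_const.
    apply: poly_familyM; last exact: poly_family_const.
    exact: poly_family_torus_jacobian.
  case: ifP => [/forallP mK|_]; last exact: bdeg0.
  have mX : bdeg (fun beta => blockdeg b beta m) ('X_[m] : {mpoly C[d]}) by exact: bdegX.
  by apply: bdegW (bdegM (bdeg_torus_jacobian sf) mX) => beta; rewrite addnC.
apply: generic_imp (generic_and gen1 gen2) => f sf [f1 f2].
have fspan k : (forall beta, k1 <= k beta)%N -> spans_at (fun i : 'I_N => u ^+ i) f k.
  move=> kk; apply: spans_at_extend f1 _ kk => i l.
  have Xl : bdeg (fun=> 1%N) ('X_l : {mpoly C[d]}).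
    by apply: bdegX => beta; rewrite blockdegU leq_b1.
  by apply: bdegW (bdegM (uX i) Xl) => beta; rewrite /k1 addn1.
have Uf x : (forall j, (f j).@[x] = 0) -> (torus_jacobian f).@[x] != 0.
  move=> fx; apply/negP => /eqP Ux.
  (* 1 is a combination of multiples of the torus Jacobian and of the equations, which would all
     vanish at [x]. *)
  have : (1 : {mpoly C[d]}).@[x] = 0.
    elim: (f2 1 (bdeg1 _ _)) => [|a v w H _ IH]; first by rewrite meval0.
    suff v0 : v.@[x] = 0 by rewrite mevalD mevalZ IH v0 mulr0 addr0.
    case: H => [[m ->]|[j [h [k' [_ _ ->]]]]]; last by rewrite mevalM fx mul0r.
    by rewrite /E; case: ifP => _; rewrite ?meval0 // mevalM Ux mul0r.
  by move/eqP; rewrite meval1 oner_eq0.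
have [zz [zz_inj zzP]] := @monogenic_solutions C d f u N (spans_at_all fspan)
  (fun q => powers_free sp sf u1 pspan fspan z_inj pz)
  (fun x v fx => proj1 (jacobian_neq0P f x) (proj1 (proj1 (torus_jacobian_neq0 f x) (Uf x fx))) v).
exists zz; split=> // x; rewrite -zzP; split=> [[]//|fx]; split=> //.
by have /torus_jacobian_neq0[] := Uf x fx.
Qed.

End Count.

(** * The permanent *)

Section BlockPermutations.
Variables (d : nat) (B : finType) (b : 'I_d -> B).
Implicit Types (h : 'S_d) (s : seq B).

(** For [s] the list of all blocks this is the Young subgroup of the partition; general [s] allows
    counting one block at a time. *)
Definition block_perms s : {set 'S_d} :=
  [set h : 'S_d | [forall l, (b (h l) == b l) && ((b l \in s) || (h l == l))]]%SET.

Lemma block_permsP s h :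
  reflect (forall l, b (h l) = b l /\ (b l \notin s -> h l = l)) (h \in block_perms s).
Proof.
rewrite inE; apply: (iffP forallP) => H l.
  by have /andP[/eqP -> hl] := H l; split=> // /negPf bl; move: hl; rewrite bl => /eqP.
have [-> hl] := H l; rewrite eqxx /=; case: (boolP (b l \in s)) => //= bl.
by rewrite hl.
Qed.

(** Each element factors uniquely as a permutation of the block [beta] times one that fixes [beta]
    pointwise. *)
Lemma card_block_perms s : uniq s ->
  #|block_perms s| = (\prod_(beta <- s) (#|block b beta|)`!)%N.
Proof.
elim: s => [_|beta s IH /= /andP[bs us]].
  rewrite big_nil; apply/eqP/cards1P; exists (1%g : 'S_d); apply/setP => h.
  rewrite inE; apply/block_permsP/eqP => [H|-> l]; last by rewrite perm1.
  by apply/permP => l; rewrite perm1; have [_ ->] := H l.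
rewrite big_cons -IH //.
pose A := [set l | b l == beta]%SET.
have -> : #|block b beta| = #|A| by apply: eq_card => l; rewrite !inE.
rewrite -card_Sym -cardsX.
rewrite -(card_in_imset (f := fun ac : 'S_d * 'S_d => (ac.1 * ac.2)%g)); last first.
  move=> [a c] [a' c']; rewrite !finset.in_setX /= ![_ \in Sym A]inE.
  move=> /andP[aA /block_permsP cP] /andP[a'A /block_permsP c'P] E.
  have fixA (c0 : 'S_d) l : (forall l, b (c0 l) = b l /\ (b l \notin s -> c0 l = l)) ->
      l \in A -> c0 l = l.
    by move=> c0P; rewrite inE => /eqP bl; have [_ ->] := c0P l; rewrite ?bl.
  have aE : a = a'.
    apply/permP => l; have [lA|lA] := boolP (l \in A); last first.
      by rewrite !(out_perm _ lA).
    have := congr1 (fun s : 'S_d => s l) E; rewrite !permM.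
    by rewrite (fixA c) ?(perm_closed _ aA) // (fixA c') ?(perm_closed _ a'A).
  by move: E; rewrite aE => /mulgI ->.
apply: eq_card => h; apply/block_permsP/imsetP => [hP|[[a c]]]; last first.
  rewrite finset.in_setX /= [_ \in Sym A]inE => /andP[aA /block_permsP cP] -> l; rewrite permM.
  have [-> cl] := cP (a l).
  have [lA|lA] := boolP (l \in A).
    have := perm_closed l aA; rewrite lA !inE => /eqP ->.
    by move: lA; rewrite inE => /eqP ->; rewrite eqxx.
  rewrite (out_perm aA lA); split=> //; rewrite inE negb_or => /andP[_ bl].
  by have [_ ->] := cP l.
have hN : h \in 'N(A | 'P)%g.
  apply/astabsP => l; rewrite /= apermE !inE.
  by have [-> _] := hP l.
have aA : perm_on A (restr_perm A h) by exact: restr_perm_on.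
exists (restr_perm A h, ((restr_perm A h)^-1 * h)%g); last by rewrite /= mulKVg.
rewrite finset.in_setX /= [_ \in Sym A]inE aA; apply/block_permsP => l; rewrite permM.
have [lA|lA] := boolP (l \in A).
  set l' := (restr_perm A h)^-1%g l.
  have lE : restr_perm A h l' = l by rewrite permKV.
  have l'A : l' \in A by rewrite -(perm_closed l' aA) lE.
  by rewrite -(restr_permE hN l'A) lE.
rewrite -[in X in b X](out_perm aA lA) permK.
have [-> hl] := hP l; split=> // bl.
rewrite -{1}(out_perm aA lA) permK hl // inE negb_or bl andbT.
by move: lA; rewrite inE.
Qed.

Variable chi : 'I_d -> pred B.

Lemma count_fiber (F : 'I_d -> B) beta :
  count_mem beta [seq F j | j <- enum 'I_d] = #|[pred j | F j == beta]|.
Proof. by rewrite count_map -sum1_count big_enum_cond -sum1_card; apply: eq_bigl. Qed.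

(** A balanced [phi] is a rearrangement of [b], say by [s0], and the fibre is the coset of the Young
    subgroup through [s0]. *)
Lemma card_block_fiber (phi : {ffun 'I_d -> B}) : assignment b chi phi ->
  #|[set s : 'S_d | [ffun j => b (s j)] == phi]%SET| = (\prod_beta (#|block b beta|)`!)%N.
Proof.
case/andP=> _ /forallP bal.
have <- : #|block_perms (enum B)| = (\prod_beta (#|block b beta|)`!)%N.
  by rewrite card_block_perms ?enum_uniq // big_enum.
have /tuple_permP[s0 s0E] : perm_eq [tuple phi j | j < d] [tuple b l | l < d].
  by apply/allP => beta _ /=; rewrite !count_fiber.
have {}s0E j : phi j = b (s0 j).
  by have := congr1 (fun t => tnth t j) (val_inj s0E); rewrite !tnth_mktuple.
rewrite -[RHS](card_imset _ (mulgI s0)); apply: eq_card => s.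
rewrite [LHS]inE; apply/eqP/imsetP => [sE|[h /block_permsP hP ->]].
  exists (s0^-1 * s)%g; last by rewrite mulKVg.
  apply/block_permsP => l; rewrite mem_enum; split=> //.
  rewrite permM -{2}(permKV s0 l) -s0E -sE ffunE.
  by [].
by apply/ffunP => j; rewrite ffunE permM; have [-> _] := hP (s0 j).
Qed.

Lemma assignment_of_perm (s : 'S_d) :
  assignment b chi [ffun j => b (s j)] = [forall j, chi j (b (s j))].
Proof.
rewrite /assignment; set bal := balanced _ _; suff -> : bal.
  by rewrite andbT; apply: eq_forallb => j; rewrite ffunE.
apply/forallP => beta; apply/eqP; rewrite -sum1_card -[RHS]sum1_card.
rewrite [RHS](reindex_inj (@perm_inj _ s)).
by apply: eq_bigl => j; rewrite !inE ffunE.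
Qed.

Lemma card_assigned_perms :
  #|[set s : 'S_d | [forall j, chi j (b (s j))]]%SET| =
    (#|{: assignments b chi}| * \prod_beta (#|block b beta|)`!)%N.
Proof.
rewrite card_sig -sum_nat_const -sum1_card.
rewrite (partition_big (fun s : 'S_d => [ffun j => b (s j)]) (assignment b chi)) /=.
  apply: eq_bigr => phi aphi; rewrite -(card_block_fiber aphi) -sum1_card.
  apply: eq_bigl => s; rewrite !inE -assignment_of_perm.
  by case: eqP => [->|]; rewrite ?aphi ?andbF.
by move=> s; rewrite inE assignment_of_perm.
Qed.

(** Every nonzero term is the same product [w], and such terms come from the permutations counted by
    [card_assigned_perms]. *)
Lemma permanent_assignments (K : comPzRingType) (c : B -> K) :
  permanent (\matrix_(j, l) (if chi j (b l) then c (b l) else 0)) =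
    #|{: assignments b chi}|%:R * \prod_beta ((#|block b beta|)`!%:R * c beta ^+ #|block b beta|).
Proof.
pose w := \prod_l c (b l).
have wE : w = \prod_beta c beta ^+ #|block b beta|.
  rewrite /w (partition_big b xpredT) //=; apply: eq_bigr => beta _.
  by rewrite (eq_bigr (fun=> c beta)) => [|l /eqP ->]; rewrite ?prodr_const.
have term (s : 'S_d) : \prod_j (\matrix_(j, l) (if chi j (b l) then c (b l) else 0)) j (s j) =
    if [forall j, chi j (b (s j))] then w else 0.
  case: ifP => [/forallP chi_s|/negbT/forallPn[j chi_s]].
    rewrite /w [RHS](reindex_inj (@perm_inj _ s)); apply: eq_bigr => j _.
    by rewrite mxE chi_s.
  by rewrite (bigD1 j) //= mxE (negPf chi_s) mul0r.
rewrite /permanent (eq_bigr _ (fun (s : 'S_d) _ => term s)) -big_mkcond sumr_const.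
rewrite big_split /= -wE -natr_prod mulrA -natrM -card_assigned_perms mulr_natl.
by congr (_ *+ _); apply: eq_card => s; rewrite !inE.
Qed.

End BlockPermutations.

(** * From sparsity graphs to block degrees *)

Section SparsityGraph.
Variables (d : nat) (P : {set {set 'I_d}}) (G : rel 'I_d).
Hypotheses (hP : finset.partition P [set: 'I_d]) (hG : sparsity_graph P G).

(** [G] as a relation from vertices to parts; by the condition on [G], one edge into a part is as
    good as edges to all of its vertices. *)
Definition edge_to_block (j : 'I_d) : pred {set 'I_d} :=
  fun T => [exists k, (finset.pblock P k == T) && G j k].

Local Notation b := (finset.pblock P).
Local Notation N := #|{: assignments b edge_to_block}|.

Lemma pblockP k : (b k \in P) /\ k \in b k.
Proof.
have [covP _ _] := and3P hP; have kP : k \in finset.cover P by rewrite (eqP covP) inE.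
by split; [exact: pblock_mem|rewrite mem_pblock].
Qed.

Lemma pblockE T k : T \in P -> k \in T -> b k = T.
Proof. by have [_ triv _] := and3P hP => TP kT; exact: def_pblock triv TP kT. Qed.

Lemma edge_to_blockE j k : edge_to_block j (b k) = G j k.
Proof.
apply/existsP/idP => [[k' /andP[/eqP kk' Gjk']]|Gjk]; last by exists k; rewrite eqxx.
have [bP kb] := pblockP k; have [_ kb'] := pblockP k'.
by have [_ /(_ j (b k) bP)] := hG; apply=> //; exists k'; rewrite // -kk'.
Qed.

Lemma card_pblock k : #|block b (b k)| = #|b k|.
Proof.
apply: eq_card => l; rewrite !inE; apply/eqP/idP => [<-|lb].
  by have [] := pblockP l.
by have [bP _] := pblockP k; exact: pblockE.
Qed.

(** The entry for a part of size r is raised to the power r, which cancels the r! orderings of that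
    part. *)
Lemma permanent_sparsity (C : numClosedFieldType) :
  permanent (sparsity_mx C P G) = N%:R.
Proof.
pose c (T : {set 'I_d}) : C := 1 / (#|T|).-root ((#|T|)`!%:R).
have -> : sparsity_mx C P G =
    \matrix_(j, l) (if edge_to_block j (b l) then c (b l) else 0).
  by apply/matrixP => j l; rewrite !mxE edge_to_blockE.
rewrite permanent_assignments big1 ?mulr1 // => T _.
(* [T] ranges over all sets of indices; one that is not a part has empty fibre under [b] and
   contributes the factor 1. *)
have [T0|] := posnP #|block b T|; first by rewrite T0 mulr1.
case/card_gt0P=> k; rewrite inE => /eqP <-; rewrite card_pblock /c div1r exprVn.
have bk : (0 < #|b k|)%N by apply/card_gt0P; exists k; have [] := pblockP k.
by rewrite rootCK // divff // pnatr_eq0 -lt0n fact_gt0.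
Qed.

(** A monomial satisfies conditions (1) and (2) exactly when its degree in each part is at most 1;
    (3) lowers the bound to 0 for the parts without an edge from [j]. *)
Lemma sparse_systemE (C : numClosedFieldType) (f : 'I_d -> {mpoly C[d]}) :
  sparse_system P G f <-> sparse b edge_to_block f.
Proof.
split=> [[f1 f2 f3] j m fm T|sf].
  rewrite -mcoeff_msupp in fm.
  have [T0|] := posnP (blockdeg b T m); first by rewrite T0.
  rewrite /blockdeg lt0n sum_nat_eq0 => /forallPn[l]; rewrite negb_imply => /andP[/eqP bl ml].
  have GT : edge_to_block j T.
    rewrite -bl edge_to_blockE; apply: contraT => /f3/hasPn/(_ m fm).
    by rewrite ml.
  rewrite GT (bigD1 l) ?bl //= big1 ?addn0 ?(f1 _ _ fm) // => l' /andP[/eqP bl' l'l].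
  apply: contrapT => /eqP ml'; have [bP lb] := pblockP l.
  have [_ lb'] := pblockP l'.
  apply: (f2 (b l) l l' bP lb _ _ j m fm) => //; last by rewrite eq_sym.
  by rewrite bl -bl'.
have le1 j m T : m \in msupp (f j) -> (blockdeg b T m <= edge_to_block j T)%N.
  by rewrite mcoeff_msupp => fm; exact: sf.
have le_deg (m : 'X_{1..d}) l : (m l <= blockdeg b (b l) m)%N by rewrite /blockdeg (bigD1 l) //= leq_addr.
split=> [j m fm l|T j k TP jT kT jk l m fm [mj mk]|j k Gjk].
- by apply: leq_trans (le_deg m l) _; apply: leq_trans (le1 _ _ _ fm) _; exact: leq_b1.
- have := le1 _ _ T fm; rewrite /blockdeg (bigD1 j) ?(pblockE TP jT) //=.
  rewrite (bigD1 k) ?(pblockE TP kT) ?eqxx ?(eq_sym k) //= addnA => H.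
  have : (2 <= edge_to_block l T)%N.
    by apply: leq_trans H; apply: leq_trans (leq_addr _ _); rewrite -[2%N]/(1 + 1)%N leq_add ?lt0n.
  by rewrite leqNgt ltnS leq_b1.
- apply/hasPn => m fm; rewrite negbK -leqn0; apply: leq_trans (le_deg m k) _.
  by apply: leq_trans (le1 _ _ _ fm) _; rewrite edge_to_blockE (negPf Gjk).
Qed.

Lemma card_eq_family (C : numClosedFieldType) n (A : set ('I_d -> C)) (z : 'I_n -> 'I_d -> C) :
  injective z -> (forall x, A x <-> exists i, x = z i) -> (A #= `I_n)%card.
Proof.
move=> z_inj AE; have -> : A = [set z i | i in [set: 'I_n]]%classic.
  apply/seteqP; split=> x; first by rewrite AE => -[i ->]; exists i.
  by case=> i _ <-; rewrite AE; exists i.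
rewrite (card_eql (inj_card_eq _)); last by move=> i j _ _; exact: z_inj.
by rewrite card_eq_sym; exact: card_II.
Qed.

End SparsityGraph.

Unset Implicit Arguments.
Set Strict Implicit.
Set Printing Implicit Defensive.

Theorem theorem1 (R : realType) (d : nat) (hd : (0 < d)%N)
    (P : {set {set 'I_d}}) (hP : finset.partition P [set: 'I_d])
    (G : rel 'I_d) (hG : sparsity_graph P G) :
  (forall f : 'I_d -> {mpoly (complex R)[d]},
     sparse_system P G f -> zero_dimensional f ->
     exists2 n : nat, (torus_solutions f #= `I_n)%card
       & n%:R <= permanent (sparsity_mx (complex R) P G)) /\
  for_generic_coefficients P G (fun f : 'I_d -> {mpoly (complex R)[d]} =>
     exists2 n : nat, (torus_solutions f #= `I_n)%card
       & n%:R = permanent (sparsity_mx (complex R) P G)).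
Proof.
rewrite (permanent_sparsity hP hG); split=> [f sf fin_f|].
  have /finite_seqP[s sE] : finite_set (torus_solutions f).
    by apply: sub_finite_set fin_f => x [].
  pose z (i : 'I_(size (undup s))) := nth (fun=> 0) (undup s) i.
  have z_inj : injective z.
    by move=> i j /eqP; rewrite nth_uniq ?undup_uniq // => /eqP/val_inj.
  have zP x : torus_solutions f x <-> exists i, x = z i.
    rewrite sE /= -mem_undup; split=> [xs|[i ->]]; last by rewrite mem_nth.
    have ltx : (index x (undup s) < size (undup s))%N by rewrite index_mem.
    by exists (Ordinal ltx); rewrite /z nth_index.
  exists (size (undup s)); first exact: card_eq_family zP.
  rewrite ler_nat; apply: (zero_count_bound (@uncountable_complex R) _ fin_f z_inj).
    exact/(sparse_systemE hP hG).
  move=> i j; have /zP[fz _] : exists i', z i = z i' by exists i.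
  exact: fz.
(* The same polynomial [H] witnesses genericity, since [sparse_systemE] identifies the two classes
   of systems. *)
have [H [[f sf Hf] HQ]] := generic_torus_count (complex R) (finset.pblock P) (edge_to_block P G).
exists H; split; first by exists f => //; apply/(sparse_systemE hP hG).
move=> g /(sparse_systemE hP hG) sg Hg; have [z [z_inj zP]] := HQ g sg Hg.
by exists #|{: assignments (finset.pblock P) (edge_to_block P G)}| => //; exact: card_eq_family zP.
Qed.
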